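(* Suppose that the assumptions on $f_i$, $r$ and on the network/weight matrix $\mathbf W$ stated in the context hold, and let $\{(\mathbf x^t,\mathbf z^t,\mathbf u^t)\}_{t\ge0}$ be generated by MG-Skip (see context) with communication probability $p\in(0,1]$ and a stepsize $0<\alpha<\frac2L$ of the order $\alpha=\mathcal O(1/L)$. Let $(\mathbf x^\star,\mathbf z^\star,\mathbf u^\star)$ satisfy $0\in\mathcal M(\mathbf x^\star,\mathbf z^\star,\mathbf u^\star)$ and let $\Psi^0=\|\mathbf x^0-\mathbf x^\star\|_{\mathrm F}^2+\frac{\alpha^2}{p^2}\|\mathbf u^0-\mathbf u^\star\|_{\mathrm F}^2$. For any given target accuracy $\epsilon>0$, to reach $\mathbb E[\|\mathbf x^t-\mathbf x^\star\|_{\mathrm F}^2]\le\epsilon\Psi^0$, the computation complexity $T$ (number of gradient computations) is $$T=\max\left\{\mathcal O\left(\kappa\log\frac1\epsilon\right),\ \mathcal O\left(\frac1{p^2}\log\frac1\epsilon\right)\right\},$$ and the expected communication complexity $C$ (number of communications) is $$C=p\left\lfloor\frac1{\sqrt{1-\rho}}\right\rfloor T\approx\max\left\{\mathcal O\left(\frac{p\kappa}{\sqrt{1-\rho}}\log\frac1\epsilon\right),\ \mathcal O\left(\frac1{p\sqrt{1-\rho}}\log\frac1\epsilon\right)\right\}.$$ Thus, for $p\in[1/\sqrt\kappa,1]$, $$T=\mathcal O\left(\kappa\log\frac1\epsilon\right),\qquad C=\mathcal O\left(\frac{p\,\kappa}{\sqrt{1-\rho}}\log\frac1\epsilon\right),$$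 and in particular, for $p=1/\sqrt\kappa$, $$T=\mathcal O\left(\kappa\log\frac1\epsilon\right),\qquad C=\mathcal O\left(\sqrt{\frac{\kappa}{1-\rho}}\,\log\frac1\epsilon\right),$$ the latter being the communication complexity known in the literature to be optimal.
   Context: Problem: minimize $h(x)=\frac1n\sum_{i=1}^n f_i(x)+r(x)$ over $x\in\mathbb R^d$, with $f_i:\mathbb R^d\to\mathbb R$ and $r:\mathbb R^d\to\mathbb R\cup\{\infty\}$. Assumptions on the functions: each $f_i$ is $\mu_i$-strongly convex and $L_i$-smooth (differentiable with $L_i$-Lipschitz gradient), $\mu_i>0$, $L_i\ge0$; $L:=\max_i L_i$, $\mu:=\min_i\mu_i$, and $\kappa:=L/\mu$. The function $r$ is convex, closed and proper, and proximable, i.e. its proximal mapping $\mathrm{prox}_{\alpha r}(y)=\arg\min_x\{\alpha r(x)+\frac12\|x-y\|^2\}$ has an analytical solution or can be computed efficiently. Stacked notation: $\mathbf x=[x_1,\dots,x_n]^{\mathsf T}\in\mathbb R^{n\times d}$ (row $i$ is $x_i^{\mathsf T}$), $F(\mathbf x)=\sum_i f_i(x_i)$, $R(\mathbf x)=\sum_i r(x_i)$, $\nabla F(\mathbf x)=[\nabla f_1(x_1),\dots,\nabla f_n(x_n)]^{\mathsf T}\in\mathbb R^{n\times d}$; $\mathrm{prox}_{\alpha R}$ acts row-wise as $\mathrm{prox}_{\alpha r}$. $\|\cdot\|_{\mathrm F}$ is the Frobenius norm; $\partial$ is the convex subdifferential. Network: $n$ nodes joined by an undirected connected graph with edge set $\mathcal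 E$; $\mathbf W=[W_{ij}]\in\mathbb R^{n\times n}$ is symmetric and doubly stochastic ($\mathbf W=\mathbf W^{\mathsf T}$, $\mathbf W\mathbf 1=\mathbf 1$), $W_{ij}=0$ if $(i,j)\notin\mathcal E$ and $W_{ij}>0$ otherwise (each node is regarded as a neighbour of itself). Its eigenvalues satisfy $1=\lambda_1>\lambda_2\ge\dots\ge\lambda_n>-1$, and $\rho:=\max\{|\lambda_2|,|\lambda_n|\}\in(0,1)$ is the spectral radius of $\mathbf W-\frac1n\mathbf 1\mathbf 1^{\mathsf T}$. Multi-round matrix: with $\eta=\frac{1-\sqrt{1-\rho^2}}{1+\sqrt{1-\rho^2}}$, set $\mathbf M_{-1}=\mathbf M_0=\mathbf I$, $\mathbf M_{k+1}=(1+\eta)\mathbf W\mathbf M_k-\eta\mathbf M_{k-1}$ for $k=0,\dots,K-1$, and $\bar{\mathbf M}:=\mathbf M_K$ with $K=\lfloor 1/\sqrt{1-\rho}\rfloor$. Applying $\bar{\mathbf M}$ costs $K$ consecutive communication rounds. Standing property of $\bar{\mathbf M}$: $\frac12(\mathbf I-\bar{\mathbf M})$ is symmetric positive semidefinite, $\sqrt{\cdot}$ denotes its positive semidefinite square root, and $\frac12(\mathbf I-\bar{\mathbf M})\mathbf x=0\Leftrightarrow\sqrt{\frac12(\mathbf I-\bar{\mathbf M})}\,\mathbf x=0\Leftrightarrow x_1=\dots=x_n$. The set-valued mapping $\mathcal M$: for $\mathbf x,\mathbf z,\mathbf u\in\mathbb R^{n\times d}$, $$\mathcal M(\mathbf x,\mathbf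 z,\mathbf u)=\begin{pmatrix}\mathbf z-\mathbf x+\alpha\nabla F(\mathbf x)+\alpha\sqrt{\tfrac12(\mathbf I-\bar{\mathbf M})}\,\mathbf u\\ -\sqrt{\tfrac12(\mathbf I-\bar{\mathbf M})}\,\mathbf z\\ (\mathbf x+\alpha\partial R(\mathbf x))-\left(\mathbf I-\tfrac12(\mathbf I-\bar{\mathbf M})\right)\mathbf z\end{pmatrix}.$$ MG-Skip: stepsize $\alpha>0$, probability $p\in(0,1]$; $\theta_0,\theta_1,\dots$ are independent coin flips with $\theta_t=1$ with probability $p$ and $\theta_t=0$ with probability $1-p$ (communication takes place only when $\theta_t=1$). Start from arbitrary $\mathbf x^0\in\mathbb R^{n\times d}$ and $\mathbf u^0=0$ (so $\mathbf y^0=0$). For $t\ge0$: $$\mathbf z^t=\mathbf x^t-\alpha\nabla F(\mathbf x^t)-\alpha\mathbf y^t,\quad \bar{\mathbf z}^{t+1}=\tfrac{\theta_t}{2}(\mathbf I-\bar{\mathbf M})\mathbf z^t,\quad \mathbf y^{t+1}=\mathbf y^t+\tfrac p\alpha\bar{\mathbf z}^{t+1},\quad \mathbf x^{t+1}=\mathrm{prox}_{\alpha R}(\mathbf z^t-\bar{\mathbf z}^{t+1}),$$ where $\mathbf y^t=\sqrt{\frac12(\mathbf I-\bar{\mathbf M})}\,\mathbf u^t$ and the dual variable is updated by $\mathbf u^{t+1}=\mathbf u^t+\frac{\theta_tp}{\alpha}\sqrt{\frac12(\mathbf I-\bar{\mathbf M})}\,\mathbf z^t$.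
   Formalization: Added: on eigenvectors of W with negative eigenvalue, the eigenvalue m of M̄ satisfies −1≤m≤σ for a fixed σ<1 (else MG-Skip can diverge); α lies in [c1/L, c2/L], 0<c1≤c2<2; O-bounds are for ε≤ε0<1, with constants depending on σ, c1, c2, ε0. *)

(* Defs.v *)
From HB Require Import structures.
From mathcomp Require Import all_boot all_order all_algebra finmap.
From mathcomp Require Import all_classical all_reals all_analysis.
Set Implicit Arguments.
Unset Strict Implicit.
Unset Printing Implicit Defensive.
Import Order.TTheory GRing.Theory Num.Theory.
Import numFieldNormedType.Exports.
Local Open Scope classical_set_scope.
Local Open Scope ring_scope.

(* The library norm on matrices is the sup norm; it is used below only for the
   topology (differentiability, lower semicontinuity).  All quantitative
   conditions use the Frobenius inner product, which on 'rV_d is the Euclidean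
   one. *)
Definition dotmx (R : realType) (m d : nat) (A B : 'M[R]_(m, d)) : R :=
  \sum_i \sum_j A i j * B i j.

Definition frob (R : realType) (m d : nat) (A : 'M[R]_(m, d)) : R :=
  Num.sqrt (dotmx A A).

Definition strongly_convex (R : realType) (d : nat) (mu : R)
    (f : 'rV[R]_d -> R) : Prop :=
  forall (t : R) (x y : 'rV[R]_d), 0 <= t <= 1 ->
    f (t *: x + (1 - t) *: y) <=
      t * f x + (1 - t) * f y - mu / 2 * t * (1 - t) * frob (x - y) ^+ 2.

Definition grad (R : realType) (d : nat) (f : 'rV[R]_d -> R) (x : 'rV[R]_d) :
    'rV[R]_d :=
  \row_j 'D_(delta_mx 0 j) f x.

Definition smooth (R : realType) (d : nat) (L : R) (f : 'rV[R]_d -> R) : Prop :=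
  (forall x, differentiable f x) /\
  (forall x y, frob (grad f x - grad f y) <= L * frob (x - y)).

(* Functions into R u {+oo} have type [_ -> \bar R] and never take the value
   -oo; closed means lower semicontinuous. *)
Record closed_proper_convex (R : realType) (d : nat) (r : 'rV[R]_d -> \bar R) :
    Prop := ClosedProperConvex {
  cpc_gtNy : forall x, (-oo < r x)%E ;
  cpc_dom : exists x, (r x < +oo)%E ;
  cpc_convex : forall (t : R) (x y : 'rV[R]_d), 0 < t < 1 ->
    (r (t *: x + (1 - t)%R *: y)%R <= t%:E * r x + (1 - t)%:E * r y)%E ;
  cpc_closed : lower_semicontinuous r }.

Definition is_prox (R : realType) (d : nat) (alpha : R) (r : 'rV[R]_d -> \bar R)
    (y x : 'rV[R]_d) : Prop :=
  forall w : 'rV[R]_d,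
    (alpha%:E * r x + (2^-1 * frob (x - y) ^+ 2)%:E <=
     alpha%:E * r w + (2^-1 * frob (w - y) ^+ 2)%:E)%E.

Definition subdiff (R : realType) (m d : nat) (g : 'M[R]_(m, d) -> \bar R)
    (x : 'M[R]_(m, d)) : set 'M[R]_(m, d) :=
  [set s | forall y, (g x + (dotmx s (y - x))%:E <= g y)%E].

Definition stack_grad (R : realType) (n d : nat) (f : 'I_n -> 'rV[R]_d -> R)
    (x : 'M[R]_(n, d)) : 'M[R]_(n, d) :=
  \matrix_(i, j) grad (f i) (row i x) 0 j.

Definition stack_reg (R : realType) (n d : nat) (r : 'rV[R]_d -> \bar R)
    (x : 'M[R]_(n, d)) : \bar R :=
  (\sum_(i < n) r (row i x))%E.

Definition is_prox_stack (R : realType) (n d : nat) (alpha : R)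
    (r : 'rV[R]_d -> \bar R) (y x : 'M[R]_(n, d)) : Prop :=
  forall i, is_prox alpha r (row i y) (row i x).

Record objective_assumptions (R : realType) (n d : nat)
    (f : 'I_n -> 'rV[R]_d -> R) (mu_ L_ : 'I_n -> R) (r : 'rV[R]_d -> \bar R) :
    Prop := ObjectiveAssumptions {
  obj_mu_gt0 : forall i, 0 < mu_ i ;
  obj_L_ge0 : forall i, 0 <= L_ i ;
  obj_sconvex : forall i, strongly_convex (mu_ i) (f i) ;
  obj_smooth : forall i, smooth (L_ i) (f i) ;
  obj_reg : closed_proper_convex r }.

(* Maximum and minimum of the finite nonempty families L_ and mu_. *)
Definition Lmax (R : realType) (n : nat) (L_ : 'I_n -> R) : R := sup (range L_).
Definition mumin (R : realType) (n : nat) (mu_ : 'I_n -> R) : R :=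
  inf (range mu_).
Definition cond_nb (R : realType) (n : nat) (mu_ L_ : 'I_n -> R) : R :=
  Lmax L_ / mumin mu_.

(* [lam] lists the eigenvalues of W with multiplicity, in nonincreasing order,
   indexed from 0: lam`_0, lam`_1 and lam`_n.-1 are lambda_1, lambda_2 and
   lambda_n. *)
Definition spectrum (R : realType) (n : nat) (W : 'M[R]_n) (lam : seq R) : Prop :=
  char_poly W = \prod_(a <- lam) ('X - a%:P) /\ sorted >=%R lam.

Definition net_rho (R : realType) (n : nat) (lam : seq R) : R :=
  Num.max `|lam`_1| `|lam`_n.-1|.

Record network_assumptions (R : realType) (n : nat) (e : rel 'I_n)
    (W : 'M[R]_n) (lam : seq R) : Prop := NetworkAssumptions {
  net_size : (1 < n)%N ;
  net_sym : symmetric e ;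
  net_connected : forall i j, connect e i j ;
  net_Wsym : W^T = W ;
  net_Wstoch : W *m const_mx 1 = const_mx 1 :> 'cV[R]_n ;
  net_Wpos : forall i j, (i == j) || e i j -> 0 < W i j ;
  net_W0 : forall i j, ~~ ((i == j) || e i j) -> W i j = 0 ;
  net_spectrum : spectrum W lam ;
  net_lam1 : lam`_0 = 1 ;
  net_lam2 : lam`_1 < 1 ;
  net_lamn : -1 < lam`_n.-1 ;
  net_rho01 : 0 < net_rho n lam < 1 }.

Definition cheb_eta (R : realType) (rho : R) : R :=
  (1 - Num.sqrt (1 - rho ^+ 2)) / (1 + Num.sqrt (1 - rho ^+ 2)).

(* The iterated pair is (M_{k-1}, M_k), starting from (M_{-1}, M_0) = (I, I). *)
Definition multi_gossip (R : realType) (n : nat) (W : 'M[R]_n) (eta : R)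
    (k : nat) : 'M[R]_n :=
  (iter k (fun M : 'M[R]_n * 'M[R]_n =>
             (M.2, (1 + eta) *: (W *m M.2) - eta *: M.1)) (1%:M, 1%:M)).2.

Definition rounds (R : realType) (rho : R) : nat :=
  Num.truncn (1 / Num.sqrt (1 - rho)).

Definition Mbar (R : realType) (n : nat) (W : 'M[R]_n) (rho : R) : 'M[R]_n :=
  multi_gossip W (cheb_eta rho) (rounds rho).

Definition half_lap (R : realType) (n : nat) (W : 'M[R]_n) (rho : R) : 'M[R]_n :=
  2^-1 *: (1%:M - Mbar W rho).

(* A psd square root exists only if A is symmetric psd, and is then unique. *)
Definition is_psd_sqrt (R : realType) (n : nat) (A S : 'M[R]_n) : Prop :=
  [/\ S^T = S, forall v : 'cV[R]_n, 0 <= dotmx v (S *m v) & S *m S = A].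

(* For eigenvalues of W in [0, rho], the recursion defining Mbar yields
   eigenvalues of Mbar in [-1, 1) bounded away from 1 uniformly in rho.  For
   eigenvalues of W near -rho this fails: the eigenvalue of Mbar is about
   (-1)^K (1 + 2K) exp(-sqrt 2) for large K.  If it exceeds 1, (I - Mbar)/2 is
   not psd; if it is below -3, MG-Skip can diverge.  This condition controls the
   part of Mbar coming from negative eigenvalues of W; it is vacuous when W is
   psd. *)
Definition neg_part_damped (R : realType) (n : nat) (W : 'M[R]_n) (rho sigma : R) :
    Prop :=
  forall (lambda m : R) (v : 'cV[R]_n), v != 0 -> lambda < 0 ->
    W *m v = lambda *: v -> Mbar W rho *m v = m *: v -> -1 <= m <= sigma.

(* The set-valued map M, with A = (I - Mbar)/2 and S its psd square root. *)
Definition opM (R : realType) (n d : nat) (f : 'I_n -> 'rV[R]_d -> R)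
    (r : 'rV[R]_d -> \bar R) (alpha : R) (A S : 'M[R]_n)
    (x z u : 'M[R]_(n, d)) :
    set ('M[R]_(n, d) * 'M[R]_(n, d) * 'M[R]_(n, d)) :=
  [set w | exists2 g, subdiff (stack_reg r) x g &
    w = (z - x + alpha *: stack_grad f x + alpha *: (S *m u),
         - (S *m z),
         (x + alpha *: g) - (1%:M - A) *m z)].

(* One run of MG-Skip for a fixed sequence of coin outcomes. *)
Record mgskip_run (R : realType) (n d : nat) (f : 'I_n -> 'rV[R]_d -> R)
    (r : 'rV[R]_d -> \bar R) (alpha p : R) (A S : 'M[R]_n) (x0 : 'M[R]_(n, d))
    (theta : nat -> bool) (x z zbar y u : nat -> 'M[R]_(n, d)) : Prop :=
  MGSkipRun {
  mg_x0 : x 0%N = x0 ;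
  mg_u0 : u 0%N = 0 ;
  mg_y0 : y 0%N = 0 ;
  mg_z : forall t, z t = x t - alpha *: stack_grad f (x t) - alpha *: y t ;
  mg_zbar : forall t, zbar t.+1 = (theta t)%:R *: (A *m z t) ;
  mg_y : forall t, y t.+1 = y t + (p / alpha) *: zbar t.+1 ;
  mg_x : forall t, is_prox_stack alpha r (z t - zbar t.+1) (x t.+1) ;
  mg_u : forall t,
    u t.+1 = u t + ((theta t)%:R * p / alpha) *: (S *m z t) }.

Record bernoulli_flips (R : realType) (disp : measure_display)
    (Omega : measurableType disp) (P : probability Omega R) (p : R)
    (theta : nat -> Omega -> bool) : Prop := BernoulliFlips {
  flips_meas : forall t, measurable_fun setT (theta t) ;
  flips_law : forall t, P (theta t @^-1` [set true]) = p%:E ;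
  flips_indep : forall (J : {fset nat}) (B : nat -> set bool),
    P (\bigcap_(t in [set` J]) (theta t @^-1` B t)) =
    (\prod_(t <- J) P (theta t @^-1` B t))%E }.

(* Every iteration evaluates each local gradient once, so T iterations are T
   gradient computations (per node). *)
Definition is_complexity (R : realType) (err : nat -> \bar R) (bound : \bar R)
    (T : nat) : Prop :=
  (forall t, (T <= t)%N -> (err t <= bound)%E) /\
  (forall T', (forall t, (T' <= t)%N -> (err t <= bound)%E) -> (T <= T')%N).

(* Applying Mbar costs K communication rounds, and it is applied at iteration t
   only if theta_t = 1. *)
Definition nb_comms (R : realType) (Omega : Type) (K : nat)
    (theta : nat -> Omega -> bool) (T : nat) (w : Omega) : R :=
  \sum_(t < T) (K * theta t w)%:R.

(* Main.v *)
(* The Lyapunov function |x - xs|^2 + (alpha/p)^2 |u - us|^2 contracts in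
   expectation by max(1 - alpha (2 - alpha L) mu, 1 - p^2 delta) per iteration,
   where delta bounds the nonzero spectrum of A = (I - Mbar)/2 from below.
   Nonexpansiveness of the prox, averaging over the coin and A^2 <= A bound the
   expected next value by |w - ws|^2 + (alpha/p)^2 |u - us|^2
   - alpha^2 <u - us, A (u - us)>, where w = x - alpha grad F(x) and
   ws is its value at xs; cocoercivity of
   the gradients handles the first term, the spectral gap the last two.  Since u^t
   is orthogonal to the constants, us may be replaced by its projection.

   The gap is uniform in rho: the eigenvalues of Mbar are q_K(lambda) for
   eigenvalues lambda of W, q_K is an explicit Chebyshev combination, and the
   choices of eta and K give |q_K| <= 24/25 on [0, rho]; negative eigenvalues are
   controlled by hypothesis. *)

Require Import Defs.
From HB Require Import structures.
From mathcomp Require Import all_boot all_order all_algebra finmap.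
From mathcomp Require Import all_classical all_reals all_analysis.
From mathcomp Require Import complex spectral.
From mathcomp Require Import ring lra.
Set Implicit Arguments.
Unset Strict Implicit.
Unset Printing Implicit Defensive.
Import Order.TTheory GRing.Theory Num.Theory.
Import numFieldNormedType.Exports.
Local Open Scope classical_set_scope.
Local Open Scope ring_scope.

(* [spectral] exports another [dotmx]. *)
Local Notation dotmx := Defs.dotmx.

(** * Euclidean geometry of matrices *)

Section Frobenius.
Context {R : realType}.

Section InnerProduct.
Context {m d : nat}.
Implicit Types (A B C : 'M[R]_(m, d)) (a : R).

Lemma dotmxC A B : dotmx A B = dotmx B A.
Proof. by do 2!apply: eq_bigr => ? _; rewrite mulrC. Qed.

Lemma dotmxDl A B C : dotmx (A + B) C = dotmx A C + dotmx B C.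
Proof.
rewrite /dotmx -big_split; apply: eq_bigr => i _; rewrite -big_split /=.
by apply: eq_bigr => j _; rewrite mxE mulrDl.
Qed.

Lemma dotmxZl a A B : dotmx (a *: A) B = a * dotmx A B.
Proof.
rewrite /dotmx mulr_sumr; apply: eq_bigr => i _; rewrite mulr_sumr.
by apply: eq_bigr => j _; rewrite mxE mulrA.
Qed.

Lemma dotmxNl A B : dotmx (- A) B = - dotmx A B.
Proof. by rewrite -scaleN1r dotmxZl mulN1r. Qed.

Lemma dotmxDr A B C : dotmx C (A + B) = dotmx C A + dotmx C B.
Proof. by rewrite !(dotmxC C) dotmxDl. Qed.

Lemma dotmxZr a A B : dotmx A (a *: B) = a * dotmx A B.
Proof. by rewrite !(dotmxC A) dotmxZl. Qed.

Lemma dotmxNr A B : dotmx A (- B) = - dotmx A B.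
Proof. by rewrite !(dotmxC A) dotmxNl. Qed.

Definition dotmxE := (dotmxDl, dotmxDr, dotmxNl, dotmxNr, dotmxZl, dotmxZr).

Lemma dotmx0r A : dotmx A 0 = 0.
Proof. by rewrite -(scale0r A) dotmxZr mul0r. Qed.

Lemma dotmx_ge0 A : 0 <= dotmx A A.
Proof. by do 2!apply: sumr_ge0 => ? _; rewrite -expr2 sqr_ge0. Qed.

Lemma dotmx_eq0 A : dotmx A A = 0 -> A = 0.
Proof.
move/eqP; rewrite psumr_eq0 => [/allP A0|i _]; last first.
  by apply: sumr_ge0 => j _; rewrite -expr2 sqr_ge0.
apply/matrixP => i j; have /= := A0 i (mem_index_enum i).
rewrite psumr_eq0 => [/allP/(_ j (mem_index_enum j))/=|k _].
  by rewrite mxE -expr2 sqrf_eq0 => /eqP.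
by rewrite -expr2 sqr_ge0.
Qed.

Lemma frob_sqr A : frob A ^+ 2 = dotmx A A.
Proof. by rewrite sqr_sqrtr ?dotmx_ge0. Qed.

Lemma frob_ge0 A : 0 <= frob A.
Proof. exact: sqrtr_ge0. Qed.

Lemma dotmx_sub_sqr A B :
  dotmx (A - B) (A - B) = dotmx A A - 2 * dotmx A B + dotmx B B.
Proof. by rewrite !dotmxE (dotmxC B A); ring. Qed.

(** Cauchy-Schwarz: expand $0\le\|\langle B,B\rangle A-\langle A,B\rangle B\|^2$ and cancel one
    factor $\langle B,B\rangle$. *)
Lemma dotmx_sqr_le A B : dotmx A B ^+ 2 <= dotmx A A * dotmx B B.
Proof.
have [B0|BN0] := eqVneq (dotmx B B) 0.
  by rewrite B0 (dotmx_eq0 B0) dotmx0r expr0n mulr0.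
have B_gt0 : 0 < dotmx B B by rewrite lt_neqAle eq_sym BN0 dotmx_ge0.
have := dotmx_ge0 (dotmx B B *: A - dotmx A B *: B).
rewrite dotmx_sub_sqr !dotmxE => H.
rewrite -subr_ge0 -(pmulr_rge0 _ B_gt0); apply: le_trans H _.
by rewrite le_eqVlt; apply/orP; left; apply/eqP; ring.
Qed.

Lemma dotmx_le_frob A B : dotmx A B <= frob A * frob B.
Proof.
have AB_ge0 := mulr_ge0 (frob_ge0 A) (frob_ge0 B).
have [|/ltW AB0] := lerP (dotmx A B) 0; first by move/le_trans; apply.
rewrite -(@ler_pXn2r _ 2) ?nnegrE// exprMn !frob_sqr.
exact: dotmx_sqr_le.
Qed.

End InnerProduct.

Lemma dotmx_tr {n d : nat} (S : 'M[R]_n) (A B : 'M[R]_(n, d)) :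
  dotmx (S *m A) B = dotmx A (S^T *m B).
Proof.
transitivity (\sum_i \sum_j \sum_k S i k * A k j * B i j).
  apply: eq_bigr => i _; apply: eq_bigr => j _.
  by rewrite mxE mulr_suml.
transitivity (\sum_k \sum_j \sum_i S i k * A k j * B i j).
  rewrite exchange_big/= [RHS]exchange_big/=.
  by apply: eq_bigr => j _; rewrite exchange_big.
apply: eq_bigr => k _; apply: eq_bigr => j _; rewrite mxE mulr_sumr.
by apply: eq_bigr => i _; rewrite mxE; ring.
Qed.

Lemma dotmx_sum_col {n d : nat} (A B : 'M[R]_(n, d)) :
  dotmx A B = \sum_j dotmx (col j A) (col j B).
Proof.
rewrite /dotmx exchange_big/=; apply: eq_bigr => j _; apply: eq_bigr => i _.
by rewrite big_ord1 !mxE.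
Qed.

Lemma dotmx_sum_row {n d : nat} (A B : 'M[R]_(n, d)) :
  dotmx A B = \sum_i dotmx (row i A) (row i B).
Proof.
apply: eq_bigr => i _; rewrite /dotmx big_ord1; apply: eq_bigr => j _.
by rewrite !mxE.
Qed.

End Frobenius.

(** * Chebyshev recursion *)

Section Chebyshev.
Context {R : realType}.
Implicit Types (rho lambda x h : R) (k : nat).

(* First and second kind Chebyshev values [(T_k(x), U_{k-1}(x))]. *)
Definition cheb x k : R * R :=
  iter k (fun c => (x * c.1 - (1 - x ^+ 2) * c.2, x * c.2 + c.1)) (1, 0).

(** Pell equation. A step of [cheb] multiplies $T+U\sqrt{x^2-1}$ by $x+\sqrt{x^2-1}$, which has norm
    1, so the norm $T^2-(x^2-1)U^2$ is preserved. *)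
Lemma cheb_pell x k :
  (cheb x k).1 ^+ 2 + (1 - x ^+ 2) * (cheb x k).2 ^+ 2 = 1.
Proof.
elim: k => [|k IHk]; first by rewrite /= ; ring.
rewrite -[RHS]IHk /=; move: (cheb x k) => [t v] /=; ring.
Qed.

Lemma cheb1_le1 x k : 0 <= x <= 1 -> `|(cheb x k).1| <= 1.
Proof.
move=> x01; have := cheb_pell x k; rewrite ler_norml.
have : 0 <= (1 - x ^+ 2) * (cheb x k).2 ^+ 2.
  by apply: mulr_ge0; [nra | rewrite sqr_ge0].
move: (cheb x k).1 => t; nra.
Qed.

Lemma cheb2_le x k : 0 <= x <= 1 -> `|(cheb x k).2| <= k%:R.
Proof.
move=> x01; elim: k => [|k IHk]; first by rewrite normr0.
rewrite /= (le_trans (ler_normD _ _))// -natr1 lerD ?cheb1_le1//.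
rewrite normrM; case/andP: x01 => x0 x1; rewrite ger0_norm//.
by apply: le_trans IHk; rewrite ler_piMl.
Qed.

(* [gossip eta lambda k] is the pair (q_{k-1}(lambda), q_k(lambda)), where
   q_k(W) = [multi_gossip W eta k]. *)
Definition gossip (eta lambda : R) k : R * R :=
  iter k (fun q => (q.2, (1 + eta) * (lambda * q.2) - eta * q.1)) (1, 1).

(** With $\eta=h^2$ and $\lambda=2hx/(1+h^2)$ the recursion reads $q_{k+1}=2hx\,q_k-h^2q_{k-1}$.
    Dividing by $h^k$ leaves the Chebyshev recurrence, and $q_{-1}=q_0=1$ fixes the combination of
    $T_k$ and $U_{k-1}$. *)
Lemma gossip_cheb h x k : h != 0 ->
  let c := cheb x k in
  gossip (h ^+ 2) (2 * h / (1 + h ^+ 2) * x) k =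
    (h ^+ k * (c.1 + (1 - x * h) / h * c.2), h ^+ k * (c.1 + (x - h) * c.2)).
Proof.
move=> h0 /=; have h1 : 1 + h ^+ 2 != 0 by apply: lt0r_neq0; have := sqr_ge0 h; lra.
elim: k => [|k IHk]; first by rewrite /= !mulr0 !addr0 expr0 mul1r.
rewrite /gossip iterS -/(gossip _ _ k) IHk /=.
move: (cheb x k) => [t v] /=; congr pair; rewrite (exprS h k); field => //.
by rewrite h1 h0.
Qed.

Lemma gossip_fixed (eta : R) k : gossip eta 1 k = (1, 1).
Proof.
elim: k => [//|k IHk]; rewrite /gossip iterS -/(gossip _ _ k) IHk /=.
by congr pair; ring.
Qed.

(** This [h] turns the eigenvalue range $[0,\rho]$ into $x\in[0,1]$ in [gossip_cheb]. The last bound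
    compares the decay $1-h$ with the $\sqrt{1-\rho}$ that defines the number of rounds. *)
Lemma cheb_etaE rho (h := rho / (1 + Num.sqrt (1 - rho ^+ 2))) :
  0 < rho < 1 ->
  [/\ cheb_eta rho = h ^+ 2, rho = 2 * h / (1 + h ^+ 2), 0 < h &
      Num.sqrt (1 - rho) <= 1 - h].
Proof.
case/andP=> rho0 rho1; rewrite /h /cheb_eta; set s := Num.sqrt (1 - rho ^+ 2).
have s0 : 0 < s by rewrite sqrtr_gt0; nra.
have s2 : s ^+ 2 = 1 - rho ^+ 2 by rewrite sqr_sqrtr//; nra.
have s1 : 1 + s != 0 by apply: lt0r_neq0; lra.
set e := Num.sqrt (1 - rho).
have e0 : 0 < e by rewrite sqrtr_gt0; lra.
have e2 : e ^+ 2 = 1 - rho by rewrite sqr_sqrtr//; lra.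
have e1 : e < 1 by nra.
set b := Num.sqrt (1 + rho).
have b1 : 1 <= b by rewrite -[leLHS]sqrtr1 ler_sqrt; lra.
have sE : s = e * b.
  by rewrite /s /e /b -sqrtrM; [congr Num.sqrt; ring | lra].
have rho2 : rho ^+ 2 = (1 - s) * (1 + s) by rewrite -subr_sqr s2; ring.
have hE : (rho / (1 + s)) ^+ 2 = (1 - s) / (1 + s).
  by rewrite expr_div_n rho2 expr2 -mulf_div divff// mulr1.
split=> //; first by rewrite hE; field; rewrite s1/=; apply: lt0r_neq0; lra.
  by rewrite divr_gt0//; lra.
have -> : 1 - rho / (1 + s) = (1 + s - rho) / (1 + s) by field.
rewrite ler_pdivlMr; last lra.
have -> : rho = 1 - e ^+ 2 by rewrite e2; ring.
(* What remains is $e(1+eb)\le eb+e^2$, that is, $0\le e(1-e)(b-1)$. *)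
rewrite sE; have := mulr_ge0 (ltW e0) (mulr_ge0 (ltW (_ : 0 < 1 - e)) (_ : 0 <= b - 1)).
by move=> /(_ ltac:(lra) ltac:(lra)); lra.
Qed.

(** Rounding down a number that is at least 1 loses at most half of it:
    $1/\sqrt{1-\rho}<K+1\le2K$. *)
Lemma rounds_ge (rho : R) : 0 < rho < 1 ->
  1 / 2 <= (rounds rho)%:R * Num.sqrt (1 - rho) <= 1.
Proof.
case/andP=> rho0 rho1; rewrite /rounds; set e := Num.sqrt (1 - rho).
have e0 : 0 < e by rewrite sqrtr_gt0; lra.
have e2 : e ^+ 2 = 1 - rho by rewrite sqr_sqrtr//; lra.
have e1 : e < 1 by nra.
have ie1 : 1 <= 1 / e by rewrite ler_pdivlMr// mul1r ltW.
have /truncn_itv/andP[K1 K2] : 0 <= 1 / e by apply: le_trans ie1.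
have K3 : (1 <= Num.truncn (1 / e))%N by rewrite truncn_gt0.
apply/andP; split; last by rewrite -ler_pdivlMr.
have : (1 : R) <= (Num.truncn (1 / e))%:R by rewrite ler1n.
move: K2; rewrite ltr_pdivrMr// -natr1; nra.
Qed.

(** Both $h^K\le e^{-t}$ and $(1+t/2)^2\le e^t$ follow from $1+y\le e^y$. The exponential is
    eliminated so that the numerical bounds become polynomial. *)
Lemma pow_le_expr (h : R) (K : nat) (t := K%:R * (1 - h)) : 0 < h <= 1 ->
  h ^+ K * (1 + t / 2) ^+ 2 <= 1.
Proof.
case/andP=> h0 h1; have t0 : 0 <= t by rewrite mulr_ge0// subr_ge0.
have hexp : h ^+ K <= expR (- t).
  rewrite /t -mulrN mulrC expRM_natr; apply: lerXn2r.
  - by rewrite nnegrE ltW.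
  - by rewrite nnegrE expR_ge0.
  - by apply: le_trans (expR_ge1Dx _); lra.
have texp : (1 + t / 2) ^+ 2 <= expR t.
  have {2}-> : t = (t / 2) * 2%:R by field.
  rewrite expRM_natr; apply: lerXn2r.
  - by rewrite nnegrE; lra.
  - by rewrite nnegrE expR_ge0.
  - by apply: le_trans (expR_ge1Dx _); lra.
apply: le_trans (ler_pM _ _ hexp texp) _.
- by rewrite exprn_ge0// ltW.
- exact: sqr_ge0.
- by rewrite expRN mulVf// gt_eqF// expR_gt0.
Qed.

(* Put x = lambda / rho and t = K (1 - h), so that t >= 1/2.  The gossip value is
   h^K (T_K(x) + (x - h) U_{K-1}(x)): if h <= x, then |U_{K-1}| <= K bounds it by
   h^K (1 + t), while if x < h, then (x - h)^2 <= 1 - x^2 and the Pell equation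
   bound it by sqrt 2 h^K.  As h^K <= (1 + t/2)^-2, the first bound is at most
   24/25, its value at t = 1/2. *)
Lemma gossip_rounds_le (rho lambda : R) : 0 < rho < 1 -> 0 <= lambda <= rho ->
  `|(gossip (cheb_eta rho) lambda (rounds rho)).2| <= 24 / 25.
Proof.
move=> rho01 /andP[l0 lrho]; have [-> rhoE h0 eh] := cheb_etaE rho01.
move: (rho / _) rhoE h0 eh => h rhoE h0 eh.
have /andP[rho0 rho1] := rho01; have /andP[K1 _] := rounds_ge rho01.
set K := rounds rho in K1 *; pose x := lambda / rho.
have x01 : 0 <= x <= 1 by rewrite divr_ge0 ?(ltW rho0)//= ler_pdivrMr// mul1r.
have -> : lambda = 2 * h / (1 + h ^+ 2) * x.
  by rewrite -rhoE /x mulrC divfK// gt_eqF.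
rewrite gossip_cheb ?gt_eqF//=.
have := cheb_pell x K; have := cheb1_le1 K x01; have := cheb2_le K x01.
move: (cheb x K) => [T V] /= V1 T1 TV; rewrite normrM ger0_norm ?exprn_ge0 ?(ltW h0)//.
have e0 : 0 < Num.sqrt (1 - rho) by rewrite sqrtr_gt0; lra.
have h01 : 0 < h <= 1 by lra.
have := pow_le_expr K h01; set t := K%:R * (1 - h); set q := h ^+ K.
have q0 : 0 < q by rewrite exprn_gt0.
have t2 : 1 / 2 <= t by apply: le_trans K1 _; rewrite ler_wpM2l.
move=> qt; have [hx|xh] := lerP h x.
  have a1 : `|T + (x - h) * V| <= 1 + t.
    rewrite (le_trans (ler_normD _ _))// lerD// normrM mulrC.
    by rewrite ler_pM// ger0_norm; lra.
  apply: le_trans (_ : q * (1 + t) <= _); first by rewrite ler_pM2l.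
  have t3 : 1 + t <= 24 / 25 * (1 + t / 2) ^+ 2 by nra.
  have := ler_wpM2l (ltW q0) t3; lra.
have a2 : `|T + (x - h) * V| ^+ 2 <= 2.
  rewrite real_normK ?num_real// -[leRHS]mulr1 -TV.
  have : (x - h) ^+ 2 * V ^+ 2 <= (1 - x ^+ 2) * V ^+ 2.
    by apply: ler_wpM2r; rewrite ?sqr_ge0//; nra.
  have := sqr_ge0 (T - (x - h) * V); nra.
have q1 : q <= 16 / 25.
  have t3 : 25 / 16 <= (1 + t / 2) ^+ 2 by nra.
  have := ler_wpM2l (ltW q0) t3; lra.
(* The rational 3/2 stands in for $\sqrt2$; the product with 16/25 is again 24/25. *)
have a3 : `|T + (x - h) * V| <= 3 / 2.
  rewrite -(@ler_pXn2r _ 2) ?nnegrE//; lra.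
by apply: le_trans (ler_pM (ltW q0) _ q1 a3) _ => //; lra.
Qed.

End Chebyshev.

(** * Spectrum of the multi-round gossip matrix *)

Section Spectral.
Context {R : realType}.
Local Notation C := R[i].
Local Open Scope sesquilinear_scope.
Local Notation toC := (map_mx (real_complex R)).

Lemma conjC_real_complex (x : R) : (real_complex R x)^* = real_complex R x.
Proof. exact/CrealP/complex_realP/(ex_intro _ x). Qed.

Lemma toC_trC {m n : nat} (A : 'M[R]_(m, n)) : (toC A)^t* = toC A^T.
Proof. by apply/matrixP => i j; rewrite !mxE conjC_real_complex. Qed.

Lemma char_poly_similar {F : comUnitRingType} {n : nat} (P A : 'M[F]_n) :
  P \in unitmx -> char_poly (invmx P *m A *m P) = char_poly A.
Proof.
move=> Pu; have PcK : map_mx polyC (invmx P) *m map_mx polyC P = 1%:M.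
  by rewrite -map_mxM mulVmx// map_mx1.
rewrite /char_poly.
have -> : char_poly_mx (invmx P *m A *m P) =
    map_mx polyC (invmx P) *m char_poly_mx A *m map_mx polyC P.
  rewrite /char_poly_mx mulmxBr mulmxBl -!map_mxM; congr (_ - _).
  by rewrite scalar_mxC -mulmxA PcK mulmx1.
by rewrite !det_mulmx mulrC mulrA -det_mulmx (mulmx1C PcK) det1 mul1r.
Qed.

(** Spectral theorem over [R[i]]: [W] is hermitian there, so the diagonal is real although [P] need
    not be. Both lists of eigenvalues split the characteristic polynomial, hence agree up to
    order. *)
Lemma symmetric_diag {n : nat} (W : 'M[R]_n) (lam : seq R) :
  W^T = W -> char_poly W = \prod_(a <- lam) ('X - a%:P) ->
  exists (P : 'M[C]_n) (sp : 'I_n -> R),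
    [/\ P \is unitarymx, perm_eq lam [seq sp i | i : 'I_n] &
        toC W = P^t* *m diag_mx (toC (\row_i sp i)) *m P].
Proof.
move=> Wsym Wchar; set A := toC W.
have Areal : A \is a mxOver Num.real.
  by apply/mxOverP => i j; rewrite mxE; apply/complex_realP; exists (W i j).
have Asym : A \is symmetricmx.
  by apply/is_hermitianmxP; rewrite expr0 scale1r map_mx_id// /A map_trmx Wsym.
have /mxOverP spreal := hermitian_spectral_diag_real (realsym_hermsym Asym Areal).
have /orthomx_spectralP Adiag := symmetric_normalmx Asym Areal.
have Punit := spectral_unitarymx A.
pose sp i : R := complex.Re (spectral_diag A 0 i).
have spE : toC (\row_i sp i) = spectral_diag A.
  by apply/rowP => i; rewrite !mxE /sp RRe_real.
exists (spectralmx A), sp; split=> //; last first.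
  by rewrite spE {1}Adiag invmx_unitary.
have : perm_eq (map (real_complex R) lam)
    (map (real_complex R) [seq sp i | i : 'I_n]).
  apply: prod_XsubC_eq; rewrite -map_comp big_map big_image/=.
  transitivity (char_poly A).
    rewrite /A -map_char_poly Wchar rmorph_prod/=; apply: eq_bigr => a _.
    by rewrite map_polyXsubC.
  rewrite Adiag char_poly_similar ?spectral_unit// char_poly_trig ?diag_mx_is_trig//.
  by apply: eq_bigr => i _; rewrite -spE !mxE eqxx mulr1n.
move/(perm_map (@complex.Re R)); rewrite -!map_comp.
have -> : [seq (@complex.Re R \o real_complex R) x | x <- lam] = lam by exact: map_id.
by rewrite /image_mem [in X in _ -> X]enumT.
Qed.

(** Rayleigh quotient bound for $M=q(W)$ on the complement of a simple eigenvector [w]. In an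
    eigenbasis of [W] the form is $\sum_i q(\lambda_i)|c_i|^2$, and orthogonality to [w] removes the
    one term with $\lambda_i=a$. The diagonal form of [M] is required in every such basis because
    the basis is only chosen in the proof. *)
Lemma quadratic_form_le {n : nat} (W M : 'M[R]_n) (w : 'cV[R]_n) (a : R)
    (lam : seq R) (q : R -> R) (lo hi : R) :
  W^T = W -> char_poly W = \prod_(x <- lam) ('X - x%:P) ->
  W *m w = a *: w -> w != 0 -> count_mem a lam = 1%N ->
  (forall (P : 'M[C]_n) (sp : 'I_n -> R), P \is unitarymx ->
    toC W = P^t* *m diag_mx (toC (\row_i sp i)) *m P ->
    toC M = P^t* *m diag_mx (toC (\row_i q (sp i))) *m P) ->
  (forall x, x \in lam -> x != a -> lo <= q x <= hi) ->
  forall v : 'cV[R]_n, dotmx v w = 0 ->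
    lo * dotmx v v <= dotmx v (M *m v) <= hi * dotmx v v.
Proof.
move=> Wsym Wchar Ww w0 acount Mdiag qlam v vw.
have [P [sp [Pu lamsp Wdiag]]] := symmetric_diag Wsym Wchar.
have {}Mdiag := Mdiag P sp Pu Wdiag.
have PP : P^t* *m P = 1%:M by rewrite -invmx_unitary// mulVmx// unitarymx_unit.
pose c (u : 'cV[R]_n) := P *m toC u.
have dotE (u u' : 'cV[R]_n) : real_complex R (dotmx u u') = (toC u^T *m toC u') 0 0.
  rewrite rmorph_sum mxE; apply: eq_bigr => i _.
  by rewrite big_ord1 rmorphM !mxE.
have cE (u u' : 'cV[R]_n) :
    real_complex R (dotmx u u') = \sum_i (c u i 0)^* * c u' i 0.
  rewrite dotE -[toC u']mul1mx -PP -toC_trC !mulmxA -mulmxA.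
  have -> : (toC u)^t* *m P^t* = (c u)^t* by rewrite -map_mxM -trmx_mul.
  by rewrite mxE; apply: eq_bigr => i _; rewrite !mxE.
have normE (z : C) : z^* * z = real_complex R (complex.Re z ^+ 2 + complex.Im z ^+ 2).
  by rewrite mulrC -normCK add_Re2_Im2.
pose N i := complex.Re (c v i 0) ^+ 2 + complex.Im (c v i 0) ^+ 2.
have N0 i : 0 <= N i by rewrite addr_ge0// sqr_ge0.
have cM (u : 'cV[R]_n) (B : 'M[R]_n) (b : 'I_n -> R) i :
    toC B = P^t* *m diag_mx (toC (\row_i b i)) *m P ->
    c (B *m u) i 0 = real_complex R (b i) * c u i 0.
  move=> Bdiag; rewrite /c map_mxM Bdiag !mulmxA (unitarymxP _)// mul1mx.
  by rewrite -mulmxA mul_diag_mx !mxE.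
have vvE : dotmx v v = \sum_i N i.
  apply: (@complexI R); rewrite cE rmorph_sum; apply: eq_bigr => i _.
  exact: normE.
have vMvE : dotmx v (M *m v) = \sum_i q (sp i) * N i.
  apply: (@complexI R); rewrite cE rmorph_sum; apply: eq_bigr => i _.
  by rewrite (cM _ _ _ _ Mdiag) mulrCA normE rmorphM.
have sp_lam i : sp i \in lam.
  by rewrite (perm_mem lamsp); apply: map_f; rewrite mem_enum.
have cw0 i : sp i != a -> c w i 0 = 0.
  move=> spa; have := cM w W sp i Wdiag.
  rewrite Ww {1}/c map_mxZ -scalemxAr mxE -/(c w) => /eqP.
  rewrite -subr_eq0 -mulrBl mulf_eq0 => /orP[|/eqP//].
  by rewrite -rmorphB fmorph_eq0 subr_eq0 eq_sym (negPf spa).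
(* By [cw0] and simplicity of [a], [w] has a single nonzero coordinate [j]; so [dotmx v w = 0]
   forces the coordinate [j] of [v] to vanish. *)
have [j cwj] : exists j, c w j 0 != 0.
  apply: contrapT => cw_eq0; case/negP: w0; apply/eqP/dotmx_eq0.
  apply: (@complexI R); rewrite cE big1 ?rmorph0// => k _.
  have [->|/eqP cwk] := eqVneq (c w k 0) 0; rewrite ?mulr0//.
  by case: cw_eq0; exists k; apply/eqP.
have spj : sp j = a by apply/eqP; apply: contraNT cwj => /cw0->.
have uniq_a i : sp i = a -> i = j.
  have /card_le1_eqP a_inj : (#|[pred k | sp k == a]| <= 1)%N.
    rewrite cardE /enum_mem size_filter -[leqRHS]acount (permP lamsp).
    by rewrite /image_mem count_map enumT.
  by move=> spi; apply: a_inj; rewrite inE ?spi ?spj.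
have N_a i : sp i = a -> N i = 0.
  move/uniq_a->; have : \sum_k (c v k 0)^* * c w k 0 = 0 by rewrite -cE vw rmorph0.
  rewrite (bigD1 j)//= big1 ?addr0 => [/eqP|k kj]; last first.
    by rewrite cw0 ?mulr0//; apply: contra_neq kj => /uniq_a.
  rewrite mulf_eq0 (negPf cwj) orbF conjC_eq0 /N => /eqP->.
  by rewrite !expr0n addr0.
rewrite vvE vMvE !mulr_sumr; apply/andP; split; apply: ler_sum => i _.
all: have [/N_a->|/qlam-/(_ (sp_lam i))/andP[? ?]] := eqVneq (sp i) a; rewrite ?mulr0//.
all: by apply: ler_wpM2r.
Qed.

Lemma simdiagM {F : comNzRingType} {n : nat} (P Q : 'M[F]_n) (a b : 'rV[F]_n) :
  P *m Q = 1%:M -> Q *m diag_mx a *m P *m (Q *m diag_mx b *m P) =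
    Q *m diag_mx (\row_i (a 0 i * b 0 i)) *m P.
Proof.
move=> PQ; rewrite !mulmxA -(mulmxA _ P Q) PQ mulmx1.
by rewrite -(mulmxA Q (diag_mx a)) mulmx_diag.
Qed.

Lemma simdiagB {F : comNzRingType} {n : nat} (P Q : 'M[F]_n) (a b : 'rV[F]_n)
    (x y : F) :
  x *: (Q *m diag_mx a *m P) - y *: (Q *m diag_mx b *m P) =
    Q *m diag_mx (x *: a - y *: b) *m P.
Proof.
rewrite (_ : diag_mx (_ - _) = x *: diag_mx a - y *: diag_mx b).
  by rewrite mulmxBr mulmxBl -!scalemxAr -!scalemxAl.
by apply/matrixP => i j; rewrite !mxE mulrnBl !mulrnAr.
Qed.

(** Polynomials in [W] are diagonal in its eigenbasis. The morphism [f] carries the real recursion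
    to the complex basis; as the recursion is of second order, the induction carries both components
    of the pair. *)
Lemma multi_gossip_diag {F : comNzRingType} (f : {rmorphism R -> F}) {n : nat}
    (W : 'M[R]_n) (eta : R) k (P Q : 'M[F]_n) (sp : 'I_n -> R) :
  Q *m P = 1%:M -> map_mx f W = Q *m diag_mx (map_mx f (\row_i sp i)) *m P ->
  map_mx f (multi_gossip W eta k) =
    Q *m diag_mx (map_mx f (\row_i (gossip eta (sp i) k).2)) *m P.
Proof.
move=> QP Wdiag; have PQ := mulmx1C QP.
pose D q := Q *m diag_mx (map_mx f (\row_i q i)) *m P.
have D1 : map_mx f 1%:M = D (fun=> 1).
  rewrite /D (_ : diag_mx _ = 1%:M) ?mulmx1 ?map_mx1//.
  by apply/matrixP => i j; rewrite !mxE rmorph1.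
have DM q q' : D q *m D q' = D (fun i => q i * q' i).
  rewrite /D simdiagM//; congr (_ *m diag_mx _ *m _).
  by apply/rowP => i; rewrite !mxE rmorphM.
have DL b b' q q' : f b *: D q - f b' *: D q' = D (fun i => b * q i - b' * q' i).
  rewrite /D simdiagB; congr (_ *m diag_mx _ *m _).
  by apply/rowP => i; rewrite !mxE rmorphB !rmorphM.
suff: map_mx f (iter k (fun M : 'M[R]_n * 'M[R]_n =>
    (M.2, (1 + eta) *: (W *m M.2) - eta *: M.1)) (1%:M, 1%:M)).1 =
    D (fun i => (gossip eta (sp i) k).1) /\
  map_mx f (multi_gossip W eta k) = D (fun i => (gossip eta (sp i) k).2) by case.
rewrite /multi_gossip; elim: k => [|k [IH1 IH2]]; first by split; exact: D1.
rewrite iterS /=; split; first exact: IH2.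
by rewrite map_mxB !map_mxZ map_mxM IH1 IH2 Wdiag -/(D sp) DM DL.
Qed.

Lemma multi_gossip_eigen {n : nat} (W : 'M[R]_n) (eta lambda : R) k (v : 'cV[R]_n) :
  W *m v = lambda *: v ->
  multi_gossip W eta k *m v = (gossip eta lambda k).2 *: v.
Proof.
move=> Wv.
suff: (iter k (fun M : 'M[R]_n * 'M[R]_n =>
    (M.2, (1 + eta) *: (W *m M.2) - eta *: M.1)) (1%:M, 1%:M)).1 *m v =
    (gossip eta lambda k).1 *: v /\
  multi_gossip W eta k *m v = (gossip eta lambda k).2 *: v by case.
rewrite /multi_gossip; elim: k => [|k [IH1 IH2]].
  by rewrite !mul1mx !scale1r.
rewrite /gossip !iterS -/(gossip eta lambda k) /=; split; first exact: IH2.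
rewrite mulmxBl -!scalemxAl -mulmxA IH1 IH2 -scalemxAr Wv !scalerA -scalerBl.
by congr (_ *: _); ring.
Qed.

(** * Spectral bounds for $\frac12(I-\bar M)$ off the consensus direction *)

Section HalfLap.
Context {n : nat} {e : rel 'I_n} {W : 'M[R]_n} {lam : seq R} {sigma : R}.
Hypothesis net : network_assumptions e W lam.
Let rho := net_rho n lam.
Hypothesis damped : neg_part_damped W rho sigma.

Lemma net_lam_ind x : x \in lam -> x != 1 -> `|x| <= rho.
Proof.
have [Wchar lam_sorted] := net_spectrum net; have n1 := net_size net.
have size_lam : size lam = n.
  by have := size_char_poly W; rewrite Wchar size_prod_XsubC => -[].
move=> /(nthP 0)[[|k] kn <-]; first by rewrite (net_lam1 net) eqxx.
move=> _; have lamE i j : (i <= j < n)%N -> lam`_j <= lam`_i.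
  case/andP=> ij jn; have trans : transitive (>=%R : rel R).
    by move=> ? ? ? /[swap]; exact: le_trans.
  apply: (sorted_leq_nth trans (@lexx _ R) 0 lam_sorted); rewrite ?inE ?size_lam//.
  exact: leq_ltn_trans jn.
have l1 : lam`_k.+1 <= lam`_1 by apply: lamE; rewrite -size_lam.
have l2 : lam`_n.-1 <= lam`_k.+1.
  by apply: lamE; rewrite -ltnS prednK ?(ltnW n1)// -size_lam kn leqnn.
rewrite /rho /net_rho ler_norml lerNl !le_max; apply/andP; split.
  by apply/orP; right; rewrite -normrN (le_trans _ (ler_norm _))// lerN2.
by rewrite (le_trans l1)// ler_norm.
Qed.

(** The gap $\lambda_2<1$ in a sorted list makes 1 a simple eigenvalue, as [quadratic_form_le]
    requires. *)
Lemma net_count1 : count_mem 1 lam = 1%N.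
Proof.
have [Wchar lam_sorted] := net_spectrum net; have n1 := net_size net.
have size_lam : size lam = n.
  by have := size_char_poly W; rewrite Wchar size_prod_XsubC => -[].
move: lam_sorted n1 (net_lam1 net) (net_lam2 net); rewrite -size_lam.
case: (lam) => [|a [|b s]]//= /andP[_ bs] _ -> b1; rewrite eqxx.
rewrite (lt_eqF b1) add0n; apply/eqP.
rewrite add1n eqSS -leqn0 leqNgt -has_count -all_predC.
have trans : transitive (>=%R : rel R) by move=> ? ? ? /[swap]; exact: le_trans.
apply/allP => x xs /=.
have /allP/(_ x xs)/= xb := order_path_min trans bs.
by rewrite lt_eqF// (le_lt_trans xb).
Qed.

Lemma half_lap_ones : half_lap W rho *m const_mx 1 = 0 :> 'cV[R]_n.
Proof.
have W1 : W *m const_mx 1 = 1 *: const_mx 1 :> 'cV[R]_n.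
  by rewrite scale1r (net_Wstoch net).
rewrite /half_lap -scalemxAl mulmxBl mul1mx.
by rewrite (multi_gossip_eigen _ _ W1) gossip_fixed scale1r subrr scaler0.
Qed.

Lemma Mbar_quadratic (v : 'cV[R]_n) : dotmx v (const_mx 1) = 0 ->
  - 1 * dotmx v v <= dotmx v (Mbar W rho *m v) <=
    Num.max (24 / 25) sigma * dotmx v v.
Proof.
have [Wchar _] := net_spectrum net; have n1 := net_size net.
have n0 := ltnW n1.
apply: (quadratic_form_le (W := W) (a := 1) (lam := lam)
  (q := fun x => (gossip (cheb_eta rho) x (rounds rho)).2)) => //.
- exact: net_Wsym net.
- by rewrite scale1r (net_Wstoch net).
- apply/eqP => /matrixP/(_ (Ordinal n0) 0); rewrite !mxE => /eqP.
  by rewrite oner_eq0.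
- exact: net_count1.
- move=> P sp Pu; apply: multi_gossip_diag.
  by rewrite -invmx_unitary// mulVmx// unitarymx_unit.
move=> x xlam x1; have xrho := net_lam_ind xlam x1.
have [x0|x0] := lerP 0 x.
  have := gossip_rounds_le (net_rho01 net) (_ : 0 <= x <= rho).
  rewrite x0 -(ger0_norm x0) => /(_ xrho); rewrite (ger0_norm x0) ler_norml.
  by case/andP=> q1 q2; rewrite le_max q2 andbT; apply: le_trans q1; lra.
(* For a negative eigenvalue, the row eigenvector transposes to a column one by symmetry of [W]. It
   is an eigenvector of [Mbar] too, so [damped] applies. *)
have : eigenvalue W x by rewrite eigenvalue_root_char Wchar root_prod_XsubC.
case/eigenvalueP => u Wu u0; have Wv : W *m u^T = x *: u^T.
  by apply: trmx_inj; rewrite trmx_mul trmxK (net_Wsym net) Wu linearZ/= trmxK.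
have := damped _ x0 Wv (multi_gossip_eigen (cheb_eta rho) (rounds rho) Wv).
by rewrite trmx_eq0 => /(_ u0)/andP[-> q2]; rewrite le_max q2 orbT.
Qed.

(** Column by column, the upper bound on [Mbar] becomes the spectral gap of [half_lap], and the
    lower bound -1 becomes [half_lap] $\le I$. *)
Lemma half_lap_quadratic {d : nat} (v : 'M[R]_(n, d)) :
  const_mx 1 *m v = 0 :> 'rV[R]_d ->
  (1 - Num.max (24 / 25) sigma) / 2 * dotmx v v <=
    dotmx v (half_lap W rho *m v) <= dotmx v v.
Proof.
move=> /rowP v1; have {}v1 j : dotmx (col j v) (const_mx 1) = 0.
  have := v1 j; rewrite !mxE => <-; apply: eq_bigr => i _.
  by rewrite big_ord1 !mxE mulrC.
rewrite !(dotmx_sum_col v) mulr_sumr.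
have Av j : dotmx (col j v) (col j (half_lap W rho *m v)) = 2^-1 *
    (dotmx (col j v) (col j v) - dotmx (col j v) (Mbar W rho *m col j v)).
  rewrite /half_lap -scalemxAl mulmxBl mul1mx.
  have -> (B : 'M[R]_n) : col j (2^-1 *: (v - B *m v)) =
      2^-1 *: (col j v - B *m col j v).
    apply/matrixP => i k; rewrite !mxE; congr (_ * (_ - _)).
    by apply: eq_bigr => l _; rewrite mxE.
  by rewrite !dotmxE.
apply/andP; split; apply: ler_sum => j _; rewrite Av.
all: have /andP[M1 M2] := Mbar_quadratic (v1 j); lra.
Qed.

End HalfLap.
End Spectral.

(** * Gradient and proximal steps *)

Section Convex.
Context {R : realType}.

(** Replaces dividing by [t] and letting [t] tend to 0 in first-order arguments along a segment. *)
Lemma ge0_of_quadratic (a b : R) :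
  (forall t, 0 < t < 1 -> 0 <= t * a + t ^+ 2 * b) -> 0 <= a.
Proof.
move=> H; rewrite leNgt; apply/negP => a0.
have b0 := normr_ge0 b; have bb := ler_norm b.
(* This [t] lies in (0, 1) and satisfies $t|b|<-a$, so $a+tb<0$. *)
pose t := - a / (1 - a + `|b|) / 2.
have den : 0 < 1 - a + `|b| by lra.
have t0 : 0 < t by rewrite !divr_gt0//; lra.
have tE : t * 2 * (1 - a + `|b|) = - a by rewrite /t; field; apply: lt0r_neq0.
have t1 : t < 1 by nra.
have := H t; rewrite t0 t1 => /(_ isT).
rewrite expr2 -mulrA -mulrDr pmulr_rge0//; nra.
Qed.

Section Smooth.
Context {d : nat}.
Implicit Types (f : 'rV[R]_d -> R) (x y : 'rV[R]_d).

Lemma derive_grad f x v : differentiable f x -> 'D_v f x = dotmx (grad f x) v.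
Proof.
move=> df; rewrite deriveE// {1}(row_sum_delta v) linear_sum /dotmx big_ord1.
by apply: eq_bigr => j _; rewrite linearZ/= -deriveE// mxE mulrC.
Qed.

Lemma is_derive_line f x v (t : R) : differentiable f (x + t *: v) ->
  is_derive t 1 (fun s => f (x + s *: v)) (dotmx (grad f (x + t *: v)) v).
Proof.
move=> df; rewrite -(derive_grad _ df).
have E : (fun h : R => h^-1 *:
    (((fun s : R => f (x + s *: v)) \o shift t) (h *: 1) - f (x + t *: v))) =
   (fun h : R => h^-1 *: ((f \o shift (x + t *: v)) (h *: v) - f (x + t *: v))).
  apply/funext => h /=; congr (_ *: (f _ - _)).
  by rewrite [h *: 1]mulr1 scalerDl addrCA.
have := diff_derivable (v := v) df.
by rewrite /derivable -E => dl; apply: DeriveDef => //; rewrite /derive -E.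
Qed.

Lemma smooth_weaken L L' f : L <= L' -> smooth L f -> smooth L' f.
Proof.
move=> LL' [df fL]; split=> // x y; apply: le_trans (fL x y) _.
by rewrite ler_wpM2r ?frob_ge0.
Qed.

Lemma smooth_dot L f x y (v : 'rV[R]_d) : smooth L f ->
  dotmx (grad f x - grad f y) v <= L * frob (x - y) * frob v.
Proof.
move=> [_ fL]; apply: le_trans (dotmx_le_frob _ _) _.
by rewrite ler_wpM2r ?frob_ge0.
Qed.

Lemma frobZ (a : R) (v : 'rV[R]_d) : 0 <= a -> frob (a *: v) = a * frob v.
Proof.
move=> a0; rewrite /frob dotmxZl dotmxZr mulrA -expr2 sqrtrM ?sqr_ge0//.
by rewrite sqrtr_sqr ger0_norm.
Qed.

Lemma frobN (v : 'rV[R]_d) : frob (- v) = frob v.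
Proof. by rewrite /frob dotmxNl dotmxNr opprK. Qed.

(** Mean value theorem for [psi], the function along the segment minus its quadratic majorant. Its
    derivative is nonpositive by Cauchy-Schwarz and the Lipschitz bound. *)
Lemma descent_lemma L f x v : smooth L f ->
  f (x + v) <= f x + dotmx (grad f x) v + L / 2 * dotmx v v.
Proof.
move=> fs; have [df fL] := fs; pose b := L / 2 * dotmx v v.
pose g1 (s : R) : R := f (x + s *: v).
pose g2 (s : R) : R := s * dotmx (grad f x) v + s ^+ 2 * b.
pose psi : R -> R := g1 - g2.
pose dpsi s := dotmx (grad f (x + s *: v)) v - (dotmx (grad f x) v + 2 * s * b).
have dpsiP (s : R) : is_derive s 1 psi (dpsi s).
  have g1P : is_derive s 1 g1 (dotmx (grad f (x + s *: v)) v) by exact: is_derive_line.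
  have g2P : is_derive s 1 g2 (dotmx (grad f x) v + 2 * s * b).
    by apply: is_derive_eq; rewrite /GRing.scale/=; ring.
  exact: is_deriveB.
have [|c c01 psiE] := @MVT R psi dpsi 0 1 ltr01 (fun s _ => dpsiP s).
  apply: derivable_within_continuous => s _; exact: ex_derive.
have : dpsi c <= 0.
  move: c01; rewrite in_itv/= => /andP[c0 c1].
  have := smooth_dot (x + c *: v) x v fs.
  rewrite addrAC subrr add0r dotmxDl dotmxNl frobZ ?(ltW c0)// => H.
  rewrite /dpsi /b -frob_sqr;
  apply: (@le_trans _ _
    (L * (c * frob v) * frob v - 2 * c * (L / 2 * frob v ^+ 2))); first lra.
  by rewrite le_eqVlt; apply/orP; left; apply/eqP; field.
move: psiE; rewrite /psi !fctE /g1 /g2 scale1r scale0r addr0 !mul0r expr0n mul0r.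
rewrite expr1n !mul1r subr0 mulr1 addr0 subr0.
rewrite /b; lra.
Qed.

Lemma strongly_convex_first_order mu L f x y : 0 <= L -> smooth L f ->
  strongly_convex mu f ->
  f x + dotmx (grad f x) (y - x) + mu / 2 * dotmx (y - x) (y - x) <= f y.
Proof.
move=> L0 fs fc; set v := y - x; rewrite -subr_ge0.
(* Of the $\frac32L$, one half comes from the descent lemma taken from $x+tv$ back to $x$, and one
   unit from replacing the gradient at $x+tv$ by that at $x$. The $\mu/2$ comes from
   $t(1-t)=t-t^2$. *)
apply: (@ge0_of_quadratic _ (3 / 2 * L * dotmx v v + mu / 2 * dotmx v v)).
move=> t /andP[t0 t1]; have t01 : 0 <= t <= 1 by rewrite !ltW.
have := fc t y x t01; rewrite frob_sqr -/v.
have -> : t *: y + (1 - t) *: x = x + t *: v.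
  by rewrite /v scalerBr scalerBl scale1r addrCA addrA.
clearbody v.
have := descent_lemma (x + t *: v) (- (t *: v)) fs; rewrite addrK.
have := smooth_dot (x + t *: v) x (- v) fs.
rewrite addrAC subrr add0r frobZ ?(ltW t0)// frobN !dotmxE -frob_sqr => H1 H2 H3.
have := ler_wpM2l (ltW t0) H1; move: H2 H3.
move: (dotmx (grad f (x + t *: v)) v) (dotmx (grad f x) v) (frob v) => gt g D.
move=> H2 H3 H4; lra.
Qed.

(** Baillon-Haddad: [half] strengthens the tangent inequality by a gradient term, and adding it for
    both orders of the points gives the claim. *)
Lemma cocoercive L f x y : 0 < L -> smooth L f -> strongly_convex 0 f ->
  dotmx (grad f x - grad f y) (grad f x - grad f y) <=
    L * dotmx (grad f x - grad f y) (x - y).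
Proof.
move=> L0 fs fc.
(* At $w-D/L$, [f] lies above its tangent at [u] and below the descent bound from [w]. *)
have half u w : f u + dotmx (grad f u) (w - u) +
    (2 * L)^-1 * dotmx (grad f w - grad f u) (grad f w - grad f u) <= f w.
  set D := grad f w - grad f u.
  have DD : dotmx D D = dotmx (grad f w) D - dotmx (grad f u) D.
    by rewrite {1}/D dotmxDl dotmxNl.
  clearbody D.
  have := descent_lemma w (- (L^-1 *: D)) fs.
  have := strongly_convex_first_order u (w - L^-1 *: D) (ltW L0) fs fc.
  rewrite mul0r mul0r addr0 addrAC !dotmxE.
  have E : L / 2 * - - (L^-1 * (L^-1 * dotmx D D)) = L^-1 * dotmx D D / 2.
    by field; apply: lt0r_neq0.
  have E2 : (2 * L)^-1 * dotmx D D = L^-1 * dotmx D D / 2.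
    by field; apply: lt0r_neq0.
  move: E E2; rewrite DD.
  move: (dotmx (grad f w) D) (dotmx (grad f u) D) => p q; lra.
have := half x y; have := half y x.
rewrite -(opprB x y) -(opprB (grad f x) (grad f y)).
have : dotmx (grad f x - grad f y) (x - y) =
    dotmx (grad f x) (x - y) - dotmx (grad f y) (x - y).
  by rewrite dotmxDl dotmxNl.
set D := grad f x - grad f y; set v := x - y => Dv.
rewrite !(dotmxNl, dotmxNr, opprK) => H1 H2.
have DD : L * ((2 * L)^-1 * dotmx D D) = dotmx D D / 2.
  by field; apply: lt0r_neq0.
have := ler_wpM2l (ltW L0) (lerD H1 H2); rewrite Dv; lra.
Qed.

Lemma strongly_monotone mu L f x y : 0 <= L -> smooth L f ->
  strongly_convex mu f ->
  mu * dotmx (x - y) (x - y) <= dotmx (grad f x - grad f y) (x - y).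
Proof.
move=> L0 fs fc; have := strongly_convex_first_order x y L0 fs fc.
have := strongly_convex_first_order y x L0 fs fc.
rewrite -(opprB x y) !(dotmxNl, dotmxNr, opprK) (dotmxDl (grad f x)) dotmxNl; lra.
Qed.

Lemma strongly_convex_weaken mu mu' f : mu' <= mu ->
  strongly_convex mu f -> strongly_convex mu' f.
Proof.
move=> mumu fc t x y t01; apply: le_trans (fc t x y t01) _.
rewrite lerD2l lerN2 !ler_wpM2r ?sqr_ge0//; move: t01 => /andP[]; lra.
Qed.

(** In $\|v-\alpha D\|^2$ cocoercivity bounds $\alpha^2\|D\|^2$ by $\alpha^2L\langle D,v\rangle$.
    The remaining $-\alpha(2-\alpha L)\langle D,v\rangle$ is at most $-\alpha(2-\alpha L)\mu\|v\|^2$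
    by strong monotonicity. *)
Lemma gradient_step_contraction mu L alpha f x y : 0 < mu -> 0 < L ->
  0 <= alpha -> alpha * L <= 2 -> smooth L f -> strongly_convex mu f ->
  let w := (x - alpha *: grad f x) - (y - alpha *: grad f y) in
  dotmx w w <= (1 - alpha * (2 - alpha * L) * mu) * dotmx (x - y) (x - y).
Proof.
move=> mu0 L0 a0 aL fs fc /=.
have -> : (x - alpha *: grad f x) - (y - alpha *: grad f y) =
    (x - y) - alpha *: (grad f x - grad f y).
  by apply/rowP => j; rewrite !mxE; ring.
have := cocoercive x y L0 fs (strongly_convex_weaken (ltW mu0) fc).
have := strongly_monotone x y (ltW L0) fs fc.
rewrite (dotmx_sub_sqr _ (alpha *: _)).
set D := grad f x - grad f y; set v := x - y.
rewrite !(dotmxZl, dotmxZr) (dotmxC v).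
move: (dotmx v v) (dotmx D v) (dotmx D D) => vv Dv DD H1 H2.
have c0 : 0 <= alpha * (2 - alpha * L) by rewrite mulr_ge0// subr_ge0.
have := ler_wpM2l c0 H1; have := ler_wpM2l (mulr_ge0 a0 a0) H2; lra.
Qed.
End Smooth.

Lemma stack_gradient_contraction {n d : nat} mu L alpha
    (f : 'I_n -> 'rV[R]_d -> R) (x y : 'M[R]_(n, d)) : 0 < mu -> 0 < L ->
  0 <= alpha -> alpha * L <= 2 -> (forall i, smooth L (f i)) ->
  (forall i, strongly_convex mu (f i)) ->
  let w := (x - alpha *: stack_grad f x) - (y - alpha *: stack_grad f y) in
  dotmx w w <= (1 - alpha * (2 - alpha * L) * mu) * dotmx (x - y) (x - y).
Proof.
move=> mu0 L0 a0 aL fs fc /=; rewrite !(dotmx_sum_row (_ - _)) mulr_sumr.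
apply: ler_sum => i _.
have rowG z : row i (stack_grad f z) = grad (f i) (row i z).
  by apply/rowP => j; rewrite !mxE.
have rowB (A B : 'M[R]_(n, d)) : row i (A - B) = row i A - row i B.
  by apply/rowP => j; rewrite !mxE.
have rowZ (A : 'M[R]_(n, d)) : row i (alpha *: A) = alpha *: row i A.
  by apply/rowP => j; rewrite !mxE.
rewrite !rowB !rowZ !rowG.
exact: (gradient_step_contraction (row i x) (row i y) mu0 L0 a0 aL (fs i) (fc i)).
Qed.

(** * Proximal points and subgradients *)

Section Prox.
Context {n d : nat} {r : 'rV[R]_d -> \bar R} {alpha : R}.
Hypothesis rP : closed_proper_convex r.
Hypothesis alpha0 : 0 < alpha.

Lemma prox_fin (y x : 'rV[R]_d) : is_prox alpha r y x -> r x \is a fin_num.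
Proof.
move=> prox; have [w0 w0fin] := cpc_dom rP; have wN := cpc_gtNy rP w0.
have xN := cpc_gtNy rP x; have := prox w0.
move: w0fin wN xN; case: (r w0) => // b _ _; case: (r x) => // _.
by rewrite gt0_muley ?lte_fin// addye// -EFinM -EFinD.
Qed.

(** Optimality condition $(y-x)/\alpha\in\partial r(x)$: compare [x] with points of the segment
    towards [w], use convexity of [r], and keep the first order in [t]. *)
Lemma prox_subdiff (y x w : 'rV[R]_d) : is_prox alpha r y x ->
  (r x + (alpha^-1 * dotmx (y - x) (w - x))%:E <= r w)%E.
Proof.
move=> prox; have xfin := prox_fin prox; have := cpc_gtNy rP w.
case rwE: (r w) => [b| |] // _; last by rewrite leey.
rewrite -(fineK xfin) -EFinD lee_fin; set a := fine (r x).
rewrite -lerBrDl ler_pdivrMl// -subr_ge0.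
apply: (@ge0_of_quadratic _ (2^-1 * dotmx (w - x) (w - x))) => t /andP[t0 t1].
have t01 : 0 < t < 1 by rewrite t0 t1.
have := cpc_convex rP w x t01; have := prox (t *: w + (1 - t) *: x).
have := cpc_gtNy rP (t *: w + (1 - t) *: x).
rewrite rwE -(fineK xfin) -/a -!EFinM -!EFinD.
case: (r _) => [c| |]// _; rewrite -EFinM -EFinD !lee_fin => H1 H2.
have := le_trans H1 (lerD (ler_wpM2l (ltW alpha0) H2) (lexx _)).
have -> : t *: w + (1 - t) *: x - y = t *: (w - x) - (y - x).
  by apply/rowP => j; rewrite !mxE; ring.
rewrite !frob_sqr -(opprB y x) (dotmx_sub_sqr (t *: _)).
rewrite !(dotmxZl, dotmxZr, dotmxNl, dotmxNr, opprK).
rewrite (dotmxC (w - x) (y - x)).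
move: (dotmx (y - x) (w - x)) (dotmx (w - x) (w - x)) (dotmx (y - x) (y - x)).
move=> p q s; lra.
Qed.

Lemma prox_stack_subdiff (y x : 'M[R]_(n, d)) : is_prox_stack alpha r y x ->
  stack_reg r x \is a fin_num /\
  subdiff (stack_reg r) x (alpha^-1 *: (y - x)).
Proof.
move=> prox; split.
  by apply/sum_fin_numP => i _ _; exact: prox_fin (prox i).
move=> w; rewrite dotmxZl dotmx_sum_row mulr_sumr -sumEFin -big_split/=.
apply: lee_sum => i _.
have rowB (A B : 'M[R]_(n, d)) : row i (A - B) = row i A - row i B.
  by apply/rowP => j; rewrite !mxE.
rewrite !rowB; exact: prox_subdiff (prox i).
Qed.

Lemma stack_reg_gtNy (x : 'M[R]_(n, d)) : (-oo < stack_reg r x)%E.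
Proof.
rewrite ltNye /stack_reg; apply/negP => /eqP/esum_eqNyP[i [_ _ ri]].
by have := cpc_gtNy rP (row i x); rewrite ri.
Qed.

(** Adding the two subgradient inequalities gives $\langle x-x_s,q\rangle\ge0$, where
    $y-y_s=(x-x_s)+q$. The reference point enters through a subgradient because this is the form in
    which the fixed point of the method is given. *)
Lemma prox_nonexpansive (y x ys xs g : 'M[R]_(n, d)) :
  is_prox_stack alpha r y x -> subdiff (stack_reg r) xs g ->
  xs + alpha *: g = ys ->
  dotmx (x - xs) (x - xs) <= dotmx (y - ys) (y - ys).
Proof.
move=> /prox_stack_subdiff[xfin xsub] gsub <-.
have := gsub x; have := xsub xs; have := stack_reg_gtNy xs.
rewrite -(fineK xfin); case: (stack_reg r xs) => [b| |]//= _.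
rewrite -!EFinD !lee_fin; set a := fine _ => H1 H2.
have := lerD H1 H2; rewrite dotmxZl -(opprB x xs) !dotmxNr.
set v := x - xs => H3.
have : 0 <= dotmx (y - x) v - alpha * dotmx g v.
  rewrite -(pmulr_lge0 _ (_ : 0 < alpha^-1)) ?invr_gt0//.
  rewrite mulrBl mulrC (mulrC alpha) mulfK ?lt0r_neq0//; lra.
pose q := (y - x) - alpha *: g.
have -> : y - (xs + alpha *: g) = v + q.
  by apply/matrixP => i j; rewrite !mxE; ring.
clearbody v.
have -> : dotmx (y - x) v - alpha * dotmx g v = dotmx v q.
  by rewrite /q (dotmxC v) (dotmxDl (y - x)) dotmxNl dotmxZl.
clearbody q.
by rewrite dotmxDl !dotmxDr (dotmxC q v) => ?; have := dotmx_ge0 q; lra.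
Qed.

(** Nonexpansiveness at equal inputs, with [x'] as the reference point and $(y-x')/\alpha$ as its
    subgradient. *)
Lemma prox_stack_unique (y x x' : 'M[R]_(n, d)) :
  is_prox_stack alpha r y x -> is_prox_stack alpha r y x' -> x = x'.
Proof.
move=> px /prox_stack_subdiff[_ x'sub]; apply/eqP; rewrite -subr_eq0.
apply/eqP/dotmx_eq0/le_anti; rewrite dotmx_ge0 andbT.
have := prox_nonexpansive px x'sub (erefl _).
by rewrite scalerA divff ?lt0r_neq0// scale1r addrCA subrr addr0 subrr dotmx0r.
Qed.

End Prox.
End Convex.

(** * One-step Lyapunov analysis *)

Section Step.
Context {R : realType} {n d : nat} {A S : 'M[R]_n} {delta alpha p : R}.
Hypothesis Ssym : S^T = S.
Hypothesis SS : S *m S = A.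
Hypothesis S1 : const_mx 1 *m S = 0 :> 'rV[R]_n.
Hypothesis Abounds : forall v : 'M[R]_(n, d), const_mx 1 *m v = 0 :> 'rV[R]_d ->
  delta * dotmx v v <= dotmx v (A *m v) <= dotmx v v.
Hypothesis alpha0 : 0 < alpha.
Hypothesis p01 : 0 < p <= 1.

(* Bounds on the Lyapunov function after a step with, resp. without,
   communication; [z] and [u] stand for the errors z^t - zs and u^t - us. *)
Definition lyap_comm (z u : 'M[R]_(n, d)) : R :=
  dotmx (z - A *m z) (z - A *m z) + alpha ^+ 2 / p ^+ 2 *
    dotmx (u + (p / alpha) *: (S *m z)) (u + (p / alpha) *: (S *m z)).

Definition lyap_skip (z u : 'M[R]_(n, d)) : R :=
  dotmx z z + alpha ^+ 2 / p ^+ 2 * dotmx u u.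

(** In the mean the dual cross term is $2\alpha\langle z,Su\rangle$, exactly that of $\|z+\alpha
    Su\|^2$. What is left is $-p\langle z,(A-A^2)z\rangle\le0$, and the surplus $\alpha^2\langle
    u,Au\rangle$ in $\|w\|^2$ pays for the dual contraction through the gap. *)
Lemma lyap_mean_le (z u : 'M[R]_(n, d)) :
  const_mx 1 *m u = 0 :> 'rV[R]_d ->
  let w := z + alpha *: (S *m u) in
  p * lyap_comm z u + (1 - p) * lyap_skip z u <=
    dotmx w w + alpha ^+ 2 / p ^+ 2 * (1 - p ^+ 2 * delta) * dotmx u u.
Proof.
move=> u1 /=; have /andP[p0 p1] := p01.
have /andP[h1 _] := Abounds u1.
(* [S z] has zero column sums for any [z], so $A\le I$ applied to it yields $\langle
   z,A^2z\rangle\le\langle z,Az\rangle$ without a condition on [z]. *)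
have Sz1 : const_mx 1 *m (S *m z) = 0 :> 'rV[R]_d by rewrite mulmxA S1 mul0mx.
have /andP[_ c1] := Abounds Sz1.
have Sl (a b : 'M[R]_(n, d)) : dotmx (S *m a) b = dotmx a (S *m b).
  by rewrite dotmx_tr Ssym.
have AE (a : 'M[R]_(n, d)) : A *m a = S *m (S *m a) by rewrite mulmxA SS.
rewrite /lyap_comm /lyap_skip (dotmx_sub_sqr z) (dotmxDl u) (dotmxDl z).
rewrite !(dotmxDr u) !(dotmxDr z) !(dotmxZl, dotmxZr).
rewrite !AE !Sl in h1 c1 *.
rewrite (dotmxC u (S *m z)) Sl.
set a := dotmx z z; set e := dotmx u u in h1 *.
set b := dotmx z (S *m (S *m z)) in c1 *.
set c := dotmx z (S *m (S *m (S *m (S *m z)))) in c1 *.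
set g := dotmx z (S *m u); set h := dotmx u (S *m (S *m u)) in h1 *.
have -> : p * (a - 2 * b + c + alpha ^+ 2 / p ^+ 2 *
      (e + p / alpha * g + (p / alpha * g + p / alpha * (p / alpha * b)))) +
    (1 - p) * (a + alpha ^+ 2 / p ^+ 2 * e) =
  (a + 2 * alpha * g - p * (b - c)) + alpha ^+ 2 / p ^+ 2 * e.
  by field; rewrite !lt0r_neq0.
have -> : alpha ^+ 2 / p ^+ 2 * (1 - p ^+ 2 * delta) * e =
    alpha ^+ 2 / p ^+ 2 * e - alpha ^+ 2 * (delta * e).
  by field; rewrite !lt0r_neq0.
have := ler_wpM2l (sqr_ge0 alpha) h1.
have : 0 <= p * (b - c) by rewrite mulr_ge0 ?(ltW p0)// subr_ge0.
lra.
Qed.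

Section Run.
Context {f : 'I_n -> 'rV[R]_d -> R} {r : 'rV[R]_d -> \bar R} {mu L : R}.
Hypothesis mu0 : 0 < mu.
Hypothesis L0 : 0 < L.
Hypothesis aL : alpha * L <= 2.
Hypothesis fs : forall i, smooth L (f i).
Hypothesis fc : forall i, strongly_convex mu (f i).
Hypothesis rP : closed_proper_convex r.
Context {xs zs us g : 'M[R]_(n, d)}.
Hypothesis gsub : subdiff (stack_reg r) xs g.
Hypothesis zsE : zs - xs + alpha *: stack_grad f xs + alpha *: (S *m us) = 0.
Hypothesis Szs : S *m zs = 0.
Hypothesis xsE : xs + alpha *: g = zs.
Hypothesis us1 : const_mx 1 *m us = 0 :> 'rV[R]_d.
Context {x0 : 'M[R]_(n, d)} {theta : nat -> bool}.
Context {x z zbar y u : nat -> 'M[R]_(n, d)}.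
Hypothesis run : mgskip_run f r alpha p A S x0 theta x z zbar y u.

Definition lyap (x u : 'M[R]_(n, d)) : R :=
  dotmx (x - xs) (x - xs) + alpha ^+ 2 / p ^+ 2 * dotmx (u - us) (u - us).

Lemma lyap_ge0 a b : 0 <= lyap a b.
Proof.
by rewrite addr_ge0 ?dotmx_ge0// mulr_ge0 ?dotmx_ge0// divr_ge0 ?sqr_ge0.
Qed.

(** The dual iterate starts at 0 and moves in the range of [S], hence stays where the spectral gap
    is available. *)
Lemma mgskip_dual t : y t = S *m u t /\ const_mx 1 *m u t = 0 :> 'rV[R]_d.
Proof.
elim: t => [|t [yE u1]].
  by rewrite (mg_y0 run) (mg_u0 run) !mulmx0.
rewrite (mg_y run) (mg_u run) (mg_zbar run) yE; split; last first.
  by rewrite mulmxDr u1 -scalemxAr mulmxA S1 mul0mx scaler0 addr0.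
rewrite mulmxDr -scalemxAr mulmxA SS scalerA; congr (_ + _ *: _).
by rewrite mulrAC [p * _]mulrC.
Qed.

Lemma lyap_succ_le t : lyap (x t.+1) (u t.+1) <=
  (if theta t then lyap_comm else lyap_skip) (z t - zs) (u t - us).
Proof.
have nonexp := prox_nonexpansive rP alpha0 (mg_x run t) gsub xsE.
have Azs : A *m zs = 0 by rewrite -SS -mulmxA Szs mulmx0.
move: nonexp; rewrite /lyap (mg_u run) (mg_zbar run) /lyap_comm /lyap_skip.
case: (theta t) => /=; last first.
  by rewrite !mul0r !scale0r !addr0 subr0 lerD2r.
rewrite !mul1r scale1r !mulmxBr Azs Szs !subr0.
by rewrite (addrAC (u t)) (addrAC (z t)) lerD2r.
Qed.

Lemma lyap_contraction t :
  p * lyap_comm (z t - zs) (u t - us) + (1 - p) * lyap_skip (z t - zs) (u t - us)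
  <= Num.max (1 - alpha * (2 - alpha * L) * mu) (1 - p ^+ 2 * delta) *
     lyap (x t) (u t).
Proof.
have [yE u1] := mgskip_dual t.
have uh1 : const_mx 1 *m (u t - us) = 0 :> 'rV[R]_d.
  by rewrite mulmxBr u1 us1 subrr.
apply: le_trans (lyap_mean_le (z t - zs) uh1) _ => /=.
(* The first optimality equation cancels the dual terms, leaving a difference of two gradient
   steps. *)
have -> : z t - zs + alpha *: (S *m (u t - us)) =
    (x t - alpha *: stack_grad f (x t)) - (xs - alpha *: stack_grad f xs).
  move: zsE => /eqP; rewrite -!addrA addr_eq0 => /eqP->.
  rewrite (mg_z run) yE mulmxBr; apply/matrixP => i j; rewrite !mxE; ring.
rewrite /lyap [leRHS]mulrDr; apply: lerD.
  apply: le_trans (stack_gradient_contraction (x t) xs mu0 L0 (ltW alpha0) aL fs fc) _.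
  by rewrite ler_wpM2r ?dotmx_ge0// le_max lexx.
rewrite [leRHS]mulrCA -[leLHS]mulrA ler_wpM2l ?divr_ge0 ?sqr_ge0//.
rewrite ler_wpM2r ?dotmx_ge0//.
by rewrite le_max lexx orbT.
Qed.

End Run.
End Step.

(* The iterates are a function of the coins, because the proximal point is unique. *)
Lemma mgskip_run_determined {R : realType} {n d : nat} {f : 'I_n -> 'rV[R]_d -> R}
    {r : 'rV[R]_d -> \bar R} {alpha p : R} {A S : 'M[R]_n} {x0 : 'M[R]_(n, d)}
    {theta theta' : nat -> bool} {x z zbar y u x' z' zbar' y' u' : nat -> 'M[R]_(n, d)}
    (t : nat) :
  closed_proper_convex r -> 0 < alpha ->
  mgskip_run f r alpha p A S x0 theta x z zbar y u ->
  mgskip_run f r alpha p A S x0 theta' x' z' zbar' y' u' ->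
  (forall s, (s < t)%N -> theta s = theta' s) ->
  [/\ x t = x' t, y t = y' t & u t = u' t].
Proof.
move=> rP alpha0 run run'; elim: t => [_|t IH thetaE].
  by rewrite (mg_x0 run) (mg_x0 run') (mg_y0 run) (mg_y0 run') (mg_u0 run) (mg_u0 run').
have [|xE yE uE] := IH; first by move=> s st; apply: thetaE; exact: ltnW.
have zE : z t = z' t by rewrite (mg_z run) (mg_z run') xE yE.
have zbarE : zbar t.+1 = zbar' t.+1.
  by rewrite (mg_zbar run) (mg_zbar run') zE thetaE.
split.
- apply: (prox_stack_unique rP alpha0 (mg_x run t)).
  by rewrite zE zbarE; exact: mg_x run' t.
- by rewrite (mg_y run) (mg_y run') yE zbarE.
- by rewrite (mg_u run) (mg_u run') uE zE thetaE.
Qed.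

(** * Averaging over the coins *)

Section Flips.
Context {R : realType} {disp : measure_display} {Omega : measurableType disp}.
Context {P : probability Omega R} {p : R} {theta : nat -> Omega -> bool}.
Hypothesis flips : bernoulli_flips P p theta.

(** A pointwise form of measurability with respect to the first [t] coins. Such a [G] takes finitely
    many values, so integrability comes for free and no measurability of the iterates has to be
    assumed. *)
Definition past_determined (t : nat) (G : Omega -> R) : Prop :=
  forall w w', (forall s, (s < t)%N -> theta s w = theta s w') -> G w = G w'.

Let past (t : nat) : {fset nat} := [fset s in iota 0 t]%fset.

Let atom (t : nat) (b : t.-tuple bool) : set Omega :=
  \bigcap_(s in [set` past t]) (theta s @^-1` [set nth false b s]).

Let heads (t : nat) : set Omega := theta t @^-1` [set true].

Let mem_past t s : (s \in past t) = (s < t)%N.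
Proof. by rewrite !inE mem_iota. Qed.

Let measurable_theta s (B : set bool) : measurable (theta s @^-1` B).
Proof. by rewrite -[X in measurable X]setTI; exact: (flips_meas flips). Qed.

Let measurable_atom t (b : t.-tuple bool) : measurable (atom b).
Proof. by apply: fin_bigcap_measurable => [|s _]; [exact: finite_fset|]. Qed.

Let atomP t (b : t.-tuple bool) w :
  atom b w <-> forall s, (s < t)%N -> theta s w = nth false b s.
Proof.
split=> [bw s st|bw s]; first by apply: bw; rewrite /= mem_past.
by rewrite /= mem_past => /bw.
Qed.

(** The intersection is a cylinder over one more index, so the product formula for independent coins
    applies to it and to [atom b]. *)
Let atom_heads t (b : t.-tuple bool) :
  P (atom b `&` heads t) = (p%:E * P (atom b))%E.
Proof.
pose B s := if s == t then [set true] else [set nth false b s].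
have tpast : t \notin past t by rewrite mem_past ltnn.
have Bpast s : s \in past t -> B s = [set nth false b s].
  by rewrite /B mem_past => st; rewrite ltn_eqF.
have -> : atom b `&` heads t =
    \bigcap_(s in [set` (t |` past t)%fset]) (theta s @^-1` B s).
  apply/seteqP; split=> [w [bw tw] s|w Bw].
    rewrite /= in_fset1U => /orP[/eqP->|sp]; first by rewrite /B eqxx.
    by rewrite Bpast//; exact: bw.
  split=> [s sp|]; first by rewrite -Bpast//; apply: Bw; rewrite /= in_fset1U sp orbT.
  by have := Bw t; rewrite /B eqxx; apply; rewrite /= in_fset1U eqxx.
rewrite (flips_indep flips) big_fsetU1//= {1}/B eqxx (flips_law flips).
rewrite /atom (flips_indep flips); congr (_ * _)%E.
by apply: eq_big_seq => s sp; rewrite Bpast.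
Qed.

Section Past.
Context {t : nat} {G : Omega -> R}.
Hypothesis Gpast : past_determined t G.

(** The common value of [G] on [atom b]; the default 0 concerns empty atoms only. *)
Let value (b : t.-tuple bool) : R :=
  if pselect (exists w, atom b w) is left ex then G (projT1 (cid ex)) else 0.

Let past_sum (B : set Omega) (w : Omega) :
  (\1_B w * G w)%:E = (\sum_b (value b)%:E * (\1_(atom b `&` B) w)%:E)%E.
Proof.
(* The outcomes seen by [w] name the only atom that contains it, so one term of the sum survives. *)
pose b0 := [tuple theta i w | i < t].
have b0w : atom b0 w.
  apply/atomP => s st.
  by rewrite (nth_map (Ordinal st)) ?size_enum_ord// nth_enum_ord.
have valE : value b0 = G w.
  rewrite /value; case: pselect => [ex|nex]; last by case: nex; exists w.
  apply: Gpast => s st; move: (cid ex) => [w' /= /atomP b0w'].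
  by rewrite b0w'//; move/atomP: b0w => ->.
rewrite (bigD1 b0)//= big1 => [|b bb0].
  by rewrite adde0 -EFinM !indicE in_setI (mem_set b0w)/= mulrC valE.
rewrite ?indicE memNset ?mule0// => -[/atomP bw _]; case/eqP: bb0.
apply: eq_from_tnth => i; rewrite !(tnth_nth false).
by rewrite -bw//; move/atomP: b0w => <-.
Qed.

Let integrable_atom (B : set Omega) (b : t.-tuple bool) : measurable B ->
  P.-integrable setT (fun w => (\1_(atom b `&` B) w)%:E).
Proof. by move=> mB; apply: integrable_indic; exact: measurableI. Qed.

Let integrable_value (B : set Omega) (b : t.-tuple bool) : measurable B ->
  P.-integrable setT (fun w => (value b)%:E * (\1_(atom b `&` B) w)%:E)%E.
Proof.
by move=> mB; exact: (integrableZl measurableT (value b) (integrable_atom b mB)).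
Qed.

Lemma past_integrable (B : set Omega) : measurable B ->
  P.-integrable setT (fun w => (\1_B w * G w)%:E).
Proof.
move=> mB; under eq_fun do rewrite past_sum.
by apply: (integrable_sum measurableT) => b _; exact: integrable_value.
Qed.

Lemma past_heads_integral :
  (\int[P]_w (\1_(heads t) w * G w)%:E = p%:E * \int[P]_w (G w)%:E)%E.
Proof.
have intE (B : set Omega) : measurable B ->
    (\int[P]_w (\1_B w * G w)%:E = \sum_b (value b)%:E * P (atom b `&` B))%E.
  move=> mB; under eq_integral do rewrite past_sum.
  rewrite integral_sum//; last by move=> b; exact: integrable_value.
  apply: eq_bigr => b _; rewrite integralZl//; last exact: integrable_atom.
  by rewrite integral_indic ?setIT//; exact: measurableI.
have -> : (\int[P]_w (G w)%:E = \int[P]_w (\1_setT w * G w)%:E)%E.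
  by apply: eq_integral => w _; rewrite indicT mul1r.
rewrite !intE//; last exact: measurable_theta.
rewrite fin_num_sume_distrr//; last first.
  by move=> b b' _ _; rewrite fin_num_adde_defl// fin_numM// fin_num_measure// setIT.
by apply: eq_bigr => b _; rewrite atom_heads setIT muleCA.
Qed.

End Past.

Lemma past_determined_integrable (t : nat) (F : Omega -> R) :
  past_determined t F -> P.-integrable setT (fun w => (F w)%:E).
Proof.
move=> Fp; have := past_integrable Fp measurableT.
by under eq_fun do rewrite indicT mul1r.
Qed.

Lemma expectation_heads t : (\int[P]_w ((theta t w)%:R : R)%:E = p%:E)%E.
Proof.
rewrite -(flips_law flips t) -(setIT (theta t @^-1` _)) -integral_indic//.
apply: eq_integral => w _; congr EFin; rewrite indicE; congr (_%:R : R).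
by case E: (theta t w); [rewrite mem_set|rewrite memNset//= E].
Qed.

Lemma integrable_heads t : P.-integrable setT (fun w => ((theta t w)%:R : R)%:E).
Proof.
rewrite (_ : (fun w => _) = fun w => (\1_(heads t) w)%:E).
  by apply: integrable_indic; exact: measurable_theta.
apply/funext => w; congr EFin; rewrite indicE; congr (_%:R : R).
by case E: (theta t w); [rewrite mem_set|rewrite memNset//= /heads/= E].
Qed.

Lemma expectation_nb_comms (K T : nat) :
  'E_P[nb_comms R K theta T]%E = (p * K%:R * T%:R)%:E.
Proof.
rewrite unlock.
transitivity (\int[P]_w \sum_(t < T) (K%:R%:E * ((theta t w)%:R : R)%:E))%E.
  apply: eq_integral => w _; rewrite /nb_comms -sumEFin.
  by apply: eq_bigr => t _; rewrite natrM EFinM.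
rewrite integral_sum//; last first.
  by move=> t; exact: (integrableZl measurableT K%:R (integrable_heads t)).
transitivity (\sum_(t < T) (p * K%:R)%:E)%E; last first.
  by rewrite sumEFin sumr_const card_ord -(mulr_natr (_ * _)).
apply: eq_bigr => t _; rewrite integralZl//; last exact: integrable_heads.
by rewrite expectation_heads muleC.
Qed.

(** One step of conditional averaging without conditional expectations: the case split is [H0] plus
    the indicator of heads times [H1 - H0], and independence of coin [t] from the past turns the
    indicator into [p]. *)
Lemma expectation_step (t : nat) (c : R) (G G' H1 H0 : Omega -> R) :
  past_determined t G -> past_determined t.+1 G' ->
  past_determined t H1 -> past_determined t H0 ->
  (forall w, G' w <= if theta t w then H1 w else H0 w) ->
  (forall w, p * H1 w + (1 - p) * H0 w <= c * G w) ->
  (\int[P]_w (G' w)%:E <= c%:E * \int[P]_w (G w)%:E)%E.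
Proof.
move=> Gpast G'past H1past H0past G'le Hle.
have Dpast : past_determined t (fun w => H1 w - H0 w).
  by move=> w w' ww'; rewrite (H1past w w')// (H0past w w').
have iDh := past_integrable Dpast (measurable_theta t [set true]).
have stepE w : (if theta t w then H1 w else H0 w) =
    H0 w + \1_(heads t) w * (H1 w - H0 w).
  rewrite indicE; case E: (theta t w); last first.
    by rewrite memNset ?mul0r ?addr0//= /heads/= E.
  by rewrite mem_set// mul1r addrC subrK.
apply: (@le_trans _ _ (\int[P]_w (H0 w + \1_(heads t) w * (H1 w - H0 w))%:E)%E).
  apply: le_integral => //; first exact: past_determined_integrable G'past.
    exact: (integrableD measurableT (past_determined_integrable H0past) iDh).
  by move=> w _; rewrite lee_fin -stepE.
rewrite integralD_EFin//; last exact: past_determined_integrable H0past.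
rewrite (past_heads_integral Dpast).
rewrite -integralZl//; last exact: past_determined_integrable Dpast.
rewrite -integralZl//; last exact: past_determined_integrable Gpast.
have ipD := integrableZl measurableT p (past_determined_integrable Dpast).
rewrite -integralD//; last exact: past_determined_integrable H0past.
apply: le_integral => //.
- exact: (integrableD measurableT (past_determined_integrable H0past) ipD).
- exact: (integrableZl measurableT c (past_determined_integrable Gpast)).
move=> w _; rewrite -!EFinM -EFinD lee_fin.
by have := Hle w; lra.
Qed.

End Flips.

(** * Iteration count *)

Section Constants.
Context {R : realType} {n : nat}.
Implicit Type v : 'I_n -> R.

Lemma Lmax_ge v i : v i <= Lmax v.
Proof.
apply: ub_le_sup; last by exists i.
exists (\sum_j `|v j|) => _ [j _ <-].
by rewrite (bigD1 j)//= (le_trans (ler_norm _))// lerDl sumr_ge0.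
Qed.

Lemma mumin_le v i : mumin v <= v i.
Proof.
apply: ge_inf; last by exists i.
exists (- \sum_j `|v j|) => _ [j _ <-].
rewrite lerNl (bigD1 j)//= (le_trans (ler_norm _))// normrN lerDl.
exact: sumr_ge0.
Qed.

Lemma mumin_gt0 v : (0 < n)%N -> (forall i, 0 < v i) -> 0 < mumin v.
Proof.
move=> n0 v0; pose i0 := Ordinal n0.
(* A finite minimum is a positive lower bound of the family, hence also bounds its infimum from
   below. *)
pose m := \big[Num.min/v i0]_(j < n) v j.
have m0 : 0 < m by rewrite /m; elim/big_ind: _ => // a b a0 b0; rewrite lt_min a0.
apply: lt_le_trans m0 _; apply: lb_le_inf; first by exists (v i0), i0.
by move=> _ [j _ <-]; exact: bigmin_le.
Qed.

End Constants.

(** * Projection onto the complement of the consensus space *)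

Section Centering.
Context {R : realType} {n d : nat}.
Hypothesis n0 : (0 < n)%N.

Let J : 'M[R]_n := const_mx n%:R^-1.

Definition center (v : 'M[R]_(n, d)) : 'M[R]_(n, d) := v - J *m v.

Lemma center_ones v : const_mx 1 *m center v = 0 :> 'rV[R]_d.
Proof.
rewrite /center mulmxBr mulmxA.
rewrite (_ : (const_mx 1 : 'rV[R]_n) *m J = const_mx 1) ?subrr//.
apply/rowP => j; rewrite !mxE.
rewrite (eq_bigr (fun=> n%:R^-1)) => [|k _]; last by rewrite !mxE mul1r.
by rewrite sumr_const card_ord -[LHS]mulr_natr mulVf// pnatr_eq0 -lt0n.
Qed.

(** Pythagoras for [center v] and [J v]. Hence centering the dual solution does not increase the
    initial Lyapunov value. *)
Lemma center_le v : dotmx (center v) (center v) <= dotmx v v.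
Proof.
have Jcv : J *m center v = 0.
  apply/matrixP => i j; have /rowP/(_ j) := center_ones v; rewrite !mxE => c0.
  transitivity (n%:R^-1 * \sum_k (const_mx 1 : 'rV[R]_n) 0 k * center v k j).
    by rewrite mulr_sumr; apply: eq_bigr => k _; rewrite !mxE mul1r.
  by rewrite c0 mulr0.
have JT : J^T = J by apply/matrixP => i j; rewrite !mxE.
have vE : v = center v + J *m v by rewrite subrK.
have cJ : dotmx (center v) (J *m v) = 0.
  by rewrite -{1}JT -dotmx_tr Jcv dotmxC dotmx0r.
have pythagoras (a b : 'M[R]_(n, d)) : dotmx a b = 0 ->
    dotmx (a + b) (a + b) = dotmx a a + dotmx b b.
  by move=> ab; rewrite !dotmxE (dotmxC b) ab; ring.
by rewrite [in leRHS]vE (pythagoras _ _ cJ) lerDl dotmx_ge0.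
Qed.

Lemma mulmx_center (S : 'M[R]_n) v : const_mx 1 *m S = 0 :> 'rV[R]_n ->
  S^T = S -> S *m center v = S *m v.
Proof.
move=> S1 Ssym; rewrite /center mulmxBr mulmxA (_ : S *m J = 0) ?mul0mx ?subr0//.
apply: trmx_inj; rewrite trmx_mul Ssym trmx0; apply/matrixP => i j.
have /rowP/(_ j) := S1; rewrite !mxE => c0.
transitivity (n%:R^-1 * \sum_k (const_mx 1 : 'rV[R]_n) 0 k * S k j).
  by rewrite mulr_sumr; apply: eq_bigr => k _; rewrite !mxE mul1r.
by rewrite c0 mulr0.
Qed.

End Centering.

(** * From geometric decay to a number of iterations *)

Section Complexity.
Context {R : realType}.

(** Uses $\zeta\le e^{-(1-\zeta)}$. *)
Lemma expr_decay (zeta eps : R) (t : nat) : 0 <= zeta < 1 -> 0 < eps ->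
  ln (1 / eps) / (1 - zeta) <= t%:R -> zeta ^+ t <= eps.
Proof.
move=> /andP[z0 z1] eps0; rewrite ler_pdivrMr ?subr_gt0// => teps.
apply: le_trans (_ : expR (- (1 - zeta)) ^+ t <= _).
  apply: lerXn2r; rewrite ?nnegrE ?expR_ge0//.
  by apply: le_trans (expR_ge1Dx _); lra.
rewrite -expRM_natr -[leRHS]lnK ?posrE// ler_expR.
by rewrite -[ln eps]opprK -lnV ?posrE// -div1r; lra.
Qed.

Lemma complexity_exists (err : nat -> \bar R) (bound : \bar R) (T' : nat) :
  (forall t, (T' <= t)%N -> (err t <= bound)%E) ->
  exists2 T, is_complexity err bound T & (T <= T')%N.
Proof.
move=> errT'; pose Q T := `[< forall t, (T <= t)%N -> (err t <= bound)%E >].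
have QT' : Q T' by exact/asboolP.
case: (ex_minnP (ex_intro _ T' QT')) => T /asboolP QT Tmin.
exists T; last exact: Tmin.
by split=> // T'' H; apply: Tmin; exact/asboolP.
Qed.

(* The rounding of the iteration count costs one step, which
   [ln (1 / eps0) <= ln (1 / eps)] absorbs into the constant. *)
Lemma iteration_bound (c' delta eps0 eps kappa p : R) :
  0 < c' -> 0 < delta -> 0 < eps0 < 1 -> 0 < eps <= eps0 -> 0 < kappa ->
  0 < p <= 1 ->
  let zeta := Num.max (1 - c' / kappa) (1 - p ^+ 2 * delta) in
  (Num.truncn (ln (1 / eps) / (1 - zeta))).+1%:R <=
    (1 / c' + 1 / delta + 1 / ln (1 / eps0)) *
    (Num.max kappa (1 / p ^+ 2) * ln (1 / eps)).
Proof.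
move=> c'0 d0 /andP[e00 e01] /andP[e0 ee0] k0 /andP[p0 p1] /=.
set zeta := Num.max (1 - c' / kappa) _.
have l0 : 0 < ln (1 / eps0) by rewrite ln_gt0// ltr_pdivlMr// mul1r.
have ll : ln (1 / eps0) <= ln (1 / eps).
  by rewrite ler_ln ?posrE ?divr_gt0// !div1r lef_pV2 ?posrE.
set l := ln (1 / eps) in ll *; have lpos := lt_le_trans l0 ll.
set M := Num.max kappa _.
have Mk : kappa <= M by rewrite le_max lexx.
have Mp : 1 / p ^+ 2 <= M by rewrite le_max lexx orbT.
have M1 : 1 <= M.
  by apply: le_trans Mp; rewrite ler_pdivlMr ?exprn_gt0// mul1r; nra.
have lM : l / (1 - zeta) <= (1 / c' + 1 / delta) * (M * l).
  have [->|->] : zeta = 1 - c' / kappa \/ zeta = 1 - p ^+ 2 * delta.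
  - by rewrite /zeta; case: leP; auto.
  - have -> : l / (1 - (1 - c' / kappa)) = 1 / c' * (kappa * l).
      by field; rewrite !lt0r_neq0.
    apply: ler_pM.
    - by rewrite divr_ge0 ?(ltW c'0).
    - by rewrite mulr_ge0 ?(ltW k0) ?(ltW lpos).
    - by rewrite lerDl divr_ge0// ltW.
    - by rewrite ler_wpM2r// ltW.
  have -> : l / (1 - (1 - p ^+ 2 * delta)) = 1 / delta * (1 / p ^+ 2 * l).
    have -> : 1 - (1 - p ^+ 2 * delta) = p ^+ 2 * delta by ring.
    field; by rewrite !lt0r_neq0.
  apply: ler_pM.
  - by rewrite divr_ge0 ?(ltW d0).
  - by rewrite mulr_ge0 ?divr_ge0 ?sqr_ge0 ?(ltW lpos).
  - by rewrite lerDr divr_ge0// ltW.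
  - by rewrite ler_wpM2r// ltW.
have one : 1 <= 1 / ln (1 / eps0) * (M * l).
  have -> : 1 / ln (1 / eps0) * (M * l) = M * (l / ln (1 / eps0)) by ring.
  rewrite -[leLHS]mulr1; apply: ler_pM => //.
  by rewrite ler_pdivlMr// (mul1r (ln _)).
rewrite -natr1 [leRHS]mulrDl lerD//; apply: le_trans lM.
rewrite truncn_le divr_ge0// ?(ltW lpos)// subr_ge0.
by rewrite /zeta ge_max !gerBl divr_ge0 ?(ltW c'0) ?(ltW k0)// mulr_ge0 ?sqr_ge0// ltW.
Qed.

End Complexity.

(** * Linear convergence in expectation *)

Section ErrorBound.
Context {R : realType} {n d : nat} {f : 'I_n -> 'rV[R]_d -> R}.
Context {mu_ L_ : 'I_n -> R} {r : 'rV[R]_d -> \bar R} {e : rel 'I_n}.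
Context {W : 'M[R]_n} {lam : seq R} {S : 'M[R]_n} {alpha p sigma : R}.
Context {disp : measure_display} {Omega : measurableType disp}.
Context {P : probability Omega R} {theta : nat -> Omega -> bool}.
Context {x0 : 'M[R]_(n, d)} {x z zbar y u : nat -> Omega -> 'M[R]_(n, d)}.
Context {xs zs us : 'M[R]_(n, d)}.
Let L := Lmax L_.
Let mu := mumin mu_.
Let rho := net_rho n lam.
Let A := half_lap W rho.
Let delta := (1 - Num.max (24 / 25) sigma) / 2.
Hypothesis obj : objective_assumptions f mu_ L_ r.
Hypothesis net : network_assumptions e W lam.
Hypothesis sqrtA : is_psd_sqrt A S.
Hypothesis damped : neg_part_damped W rho sigma.
Hypothesis p01 : 0 < p <= 1.
Hypothesis L0 : 0 < L.
Hypothesis alpha0 : 0 < alpha.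
Hypothesis aL : alpha * L <= 2.
Hypothesis flips : bernoulli_flips P p theta.
Hypothesis run : forall w, mgskip_run f r alpha p A S x0 (theta^~ w)
  (x^~ w) (z^~ w) (zbar^~ w) (y^~ w) (u^~ w).
Hypothesis fixpt : opM f r alpha A S xs zs us (0, 0, 0).

Let n0 : (0 < n)%N. Proof. exact: ltnW (net_size net). Qed.
Let Ssym : S^T = S. Proof. by case: sqrtA. Qed.
Let SS : S *m S = A. Proof. by case: sqrtA. Qed.
Let rP : closed_proper_convex r. Proof. exact: obj_reg obj. Qed.

(** $\|S\mathbf 1\|^2=\langle\mathbf 1,A\mathbf 1\rangle=0$, then transpose. *)
Let S1 : const_mx 1 *m S = 0 :> 'rV[R]_n.
Proof.
have S1 : S *m const_mx 1 = 0 :> 'cV[R]_n.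
  apply: dotmx_eq0; rewrite dotmx_tr Ssym mulmxA SS.
  by rewrite (half_lap_ones net) dotmx0r.
by apply: trmx_inj; rewrite trmx_mul Ssym trmx_const S1 trmx0.
Qed.

Let Abounds (v : 'M[R]_(n, d)) : const_mx 1 *m v = 0 :> 'rV[R]_d ->
  delta * dotmx v v <= dotmx v (A *m v) <= dotmx v v.
Proof. exact: half_lap_quadratic net damped _ v. Qed.

(* [center us] is again a dual solution, and unlike [us] it lies in the space
   orthogonal to the consensus direction, where the dual iterates live. *)
Let usc := center us.

Lemma lyap_center_le : lyap (alpha := alpha) (p := p) (xs := xs) (us := usc) x0 0 <=
  frob (x0 - xs) ^+ 2 + alpha ^+ 2 / p ^+ 2 * frob (0 - us) ^+ 2.
Proof.
rewrite /lyap !frob_sqr lerD2l ler_wpM2l ?divr_ge0 ?sqr_ge0//.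
by rewrite !sub0r !dotmxNl !dotmxNr !opprK center_le.
Qed.

(** Any [c] above the true rate is allowed, so that a rate depending on [kappa] and [p] alone, up to
    fixed constants, can be substituted. *)
Lemma expected_error_le (c : R) t :
  Num.max (1 - alpha * (2 - alpha * L) * mu) (1 - p ^+ 2 * delta) <= c ->
  0 <= c ->
  ('E_P[fun w => (frob (x t w - xs) ^+ 2)%R] <=
    (c ^+ t * (frob (x0 - xs) ^+ 2 +
      alpha ^+ 2 / p ^+ 2 * frob (0 - us) ^+ 2))%:E)%E.
Proof.
move=> zetac c0; have [g gsub /pair_equal_spec[/pair_equal_spec[zsE Szs] xsE]] := fixpt.
have {}Szs : S *m zs = 0 by apply/eqP; rewrite -oppr_eq0 -Szs.
(* As $A=SS$, the equation [S zs = 0] also removes [A zs] from the third component. *)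
have {}xsE : xs + alpha *: g = zs.
  apply/eqP; rewrite -subr_eq0 {1}xsE mulmxBl mul1mx -SS -mulmxA Szs mulmx0 subr0.
  by rewrite eqxx.
have {}zsE : zs - xs + alpha *: stack_grad f xs + alpha *: (S *m usc) = 0.
  by rewrite (mulmx_center us S1 Ssym).
have fs i : smooth L (f i) by apply: smooth_weaken (obj_smooth obj i); exact: Lmax_ge.
have mu0 : 0 < mu by apply: mumin_gt0 => //; exact: obj_mu_gt0 obj.
have fc i : strongly_convex mu (f i).
  by apply: strongly_convex_weaken (obj_sconvex obj i); exact: mumin_le.
pose Lyap := lyap (alpha := alpha) (p := p) (xs := xs) (us := usc).
pose Psi t w := Lyap (x t w) (u t w).
have det s w w' : (forall k, (k < s)%N -> theta k w = theta k w') ->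
    [/\ x s w = x s w', y s w = y s w' & u s w = u s w'].
  exact: mgskip_run_determined rP alpha0 (run w) (run w').
have zdet s w w' : (forall k, (k < s)%N -> theta k w = theta k w') -> z s w = z s w'.
  by move=> /det[xE yE _]; rewrite (mg_z (run w)) (mg_z (run w')) xE yE.
have Psidet s : past_determined (theta := theta) s (Psi s).
  by move=> w w' /det[xE _ uE]; rewrite /Psi xE uE.
have us1 : const_mx 1 *m usc = 0 :> 'rV[R]_d by exact: center_ones.
have step s : (\int[P]_w (Psi s.+1 w)%:E <= c%:E * \int[P]_w (Psi s w)%:E)%E.
  apply: (expectation_step flips (t := s)
    (H1 := fun w => lyap_comm (A := A) (S := S) (alpha := alpha) (p := p)
      (z s w - zs) (u s w - usc))
    (H0 := fun w => lyap_skip (alpha := alpha) (p := p)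
      (z s w - zs) (u s w - usc))).
  - exact: (Psidet s).
  - exact: (Psidet s.+1).
  - by move=> w w' ww'; have [_ _ ->] := det _ _ _ ww'; rewrite (zdet _ _ _ ww').
  - by move=> w w' ww'; have [_ _ ->] := det _ _ _ ww'; rewrite (zdet _ _ _ ww').
  - move=> w; have := lyap_succ_le (us := usc) SS alpha0 rP gsub Szs xsE (run w) s.
    by rewrite /Psi/=; case: (theta s w).
  - move=> w; have := lyap_contraction Ssym SS S1 Abounds alpha0 p01 mu0 L0
      aL fs fc zsE us1 (run w) s.
    by move/le_trans; apply; rewrite ler_wpM2r// lyap_ge0.
have Psi_int s := past_determined_integrable flips (Psidet s).
have decay s : (\int[P]_w (Psi s w)%:E <=
    (c ^+ s * Lyap x0 0)%:E)%E.
  elim: s => [|s IH].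
    rewrite expr0 mul1r (eq_integral (cst (Lyap x0 0)%:E)).
      rewrite integral_cst// -[leRHS]mule1; apply: lee_wpmul2l.
        by rewrite lee_fin lyap_ge0.
      exact: probability_le1.
    by move=> w _; rewrite /Psi (mg_x0 (run w)) (mg_u0 (run w)).
  apply: le_trans (step s) _; rewrite exprS -mulrA EFinM.
  by rewrite lee_wpmul2l// lee_fin.
rewrite unlock; apply: (@le_trans _ _ (\int[P]_w (Psi t w)%:E)%E).
  apply: le_integral => //.
    apply: (past_determined_integrable flips (t := t)) => w w' ww'.
    by have [-> _ _] := det _ _ _ ww'.
  move=> w _; rewrite lee_fin frob_sqr lerDl.
  by rewrite mulr_ge0 ?dotmx_ge0// divr_ge0 ?sqr_ge0.
apply: le_trans (decay t) _; rewrite lee_fin ler_wpM2l ?exprn_ge0//.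
exact: lyap_center_le.
Qed.

End ErrorBound.

(** The constant of the $\mathcal O$ is chosen before all problem data, from [c1], [c2], [sigma] and
    [eps0] only. The order of the stepsize is $c_1\le\alpha L\le c_2<2$, and
    $\epsilon\le\epsilon_0<1$ keeps the logarithm away from 0. *)
Theorem mainTheorem2 (R : realType) (c1 c2 : R) (hc1 : 0 < c1)
    (hc12 : c1 <= c2) (hc2 : c2 < 2) (sigma : R) (hsigma : sigma < 1)
    (eps0 : R) (heps0 : 0 < eps0 < 1) :
  exists2 Cst : R, 0 < Cst &
  forall (n d : nat) (f : 'I_n -> 'rV[R]_d -> R) (mu_ L_ : 'I_n -> R)
    (r : 'rV[R]_d -> \bar R) (e : rel 'I_n) (W : 'M[R]_n) (lam : seq R)
    (S : 'M[R]_n) (alpha p : R) (disp : measure_display)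
    (Omega : measurableType disp) (P : probability Omega R)
    (theta : nat -> Omega -> bool) (x0 : 'M[R]_(n, d))
    (x z zbar y u : nat -> Omega -> 'M[R]_(n, d)) (xs zs us : 'M[R]_(n, d)),
  let L := Lmax L_ in
  let kappa := cond_nb mu_ L_ in
  let rho := net_rho n lam in
  let K := rounds rho in
  let A := half_lap W rho in
  let Psi0 := frob (x0 - xs) ^+ 2 + alpha ^+ 2 / p ^+ 2 * frob (0 - us) ^+ 2 in
  objective_assumptions f mu_ L_ r ->
  network_assumptions e W lam ->
  is_psd_sqrt A S ->
  neg_part_damped W rho sigma ->
  0 < p <= 1 ->
  0 < alpha < 2 / L ->
  c1 / L <= alpha <= c2 / L ->
  bernoulli_flips P p theta ->
  (forall w, mgskip_run f r alpha p A S x0 (theta^~ w)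
     (x^~ w) (z^~ w) (zbar^~ w) (y^~ w) (u^~ w)) ->
  opM f r alpha A S xs zs us (0, 0, 0) ->
  forall eps : R, 0 < eps ->
  exists T : nat,
    let C := p * K%:R * T%:R in
    let logeps := ln (1 / eps) in
    [/\ is_complexity (fun t => 'E_P[fun w => (frob (x t w - xs) ^+ 2)%R]%E)
          (eps * Psi0)%:E T,
        'E_P[nb_comms R K theta T]%E = C%:E &
        eps <= eps0 ->
        [/\ T%:R <= Num.max (Cst * (kappa * logeps))
                            (Cst * (1 / p ^+ 2 * logeps)),
            C <= Num.max (Cst * (p * kappa / Num.sqrt (1 - rho) * logeps))
                         (Cst * (1 / (p * Num.sqrt (1 - rho)) * logeps)),
            1 / Num.sqrt kappa <= p <= 1 ->
              T%:R <= Cst * (kappa * logeps) /\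
              C <= Cst * (p * kappa / Num.sqrt (1 - rho) * logeps) &
            p = 1 / Num.sqrt kappa ->
              T%:R <= Cst * (kappa * logeps) /\
              C <= Cst * (Num.sqrt (kappa / (1 - rho)) * logeps)]].
Proof.
set delta := (1 - Num.max (24 / 25) sigma) / 2.
have delta0 : 0 < delta.
  by rewrite /delta divr_gt0// subr_gt0 gt_max hsigma andbT; lra.
have delta1 : delta <= 1.
  rewrite /delta; have : 24 / 25 <= Num.max (24 / 25) sigma by rewrite le_max lexx.
  by lra.
(* Since $\alpha(2-\alpha L)\mu=\alpha L(2-\alpha L)/\kappa$, the primal rate is at most
   $1-c'/\kappa$. *)
pose c' := c1 * (2 - c2).
have c'0 : 0 < c' by rewrite mulr_gt0// subr_gt0.
have l0 : 0 < ln (1 / eps0).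
  by case/andP: heps0 => e0 e1; rewrite ln_gt0// ltr_pdivlMr// mul1r.
(* The summands account for the primal rate, the dual rate and the rounding of the iteration
   count. *)
pose Cst := 1 / c' + 1 / delta + 1 / ln (1 / eps0).
have Cst0 : 0 < Cst by rewrite !addr_gt0// divr_gt0.
exists Cst => // n d f mu_ L_ r e W lam S alpha p disp Omega P theta x0.
move=> x z zbar y u xs zs us L kappa rho K A Psi0 obj net sqrtA damped p01.
move=> /andP[alpha0 alphaL] /andP[alpha1 alpha2] flips run fixpt eps eps_gt0.
(* Positivity of [L] is extracted from the stepsize range $0<\alpha<2/L$. *)
have L0 : 0 < L.
  by have := lt_trans alpha0 alphaL; rewrite pmulr_rgt0// invr_gt0.
have aL1 : c1 <= alpha * L by rewrite -ler_pdivrMr.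
have aL2 : alpha * L <= c2 by rewrite -ler_pdivlMr.
have mu0 : 0 < mumin mu_.
  by apply: mumin_gt0 (obj_mu_gt0 obj); exact: ltnW (net_size net).
have kappa0 : 0 < kappa by rewrite divr_gt0.
have /andP[p0 p1] := p01.
pose zeta := Num.max (1 - c' / kappa) (1 - p ^+ 2 * delta).
have zeta_ge : Num.max (1 - alpha * (2 - alpha * L) * mumin mu_)
    (1 - p ^+ 2 * delta) <= zeta.
  rewrite ge_max !le_max lexx orbT andbT lerD2l lerN2.
  rewrite /kappa /cond_nb invf_div -/L mulrA ler_pdivrMr// [leRHS]mulrAC.
  rewrite ler_wpM2r ?(ltW mu0)// mulrAC /c' ler_pM ?(ltW hc1)//; lra.
have p2 : 0 < p ^+ 2 by rewrite exprn_gt0.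
have zeta0 : 0 <= zeta.
  rewrite le_max !subr_ge0; apply/orP; right.
  apply: mulr_ile1 => //; rewrite ?(ltW p2) ?(ltW delta0)//.
  by rewrite exprn_ile1// ltW.
have zeta1 : zeta < 1.
  by rewrite gt_max !gtrBl divr_gt0// mulr_gt0.
have Psi0_ge0 : 0 <= Psi0.
  by rewrite addr_ge0 ?sqr_ge0// mulr_ge0 ?sqr_ge0// divr_ge0 ?sqr_ge0.
have aL_le2 : alpha * L <= 2 by apply: le_trans aL2 (ltW hc2).
have errP t := expected_error_le obj net sqrtA damped p01 L0 alpha0 aL_le2
  flips run fixpt t zeta_ge zeta0.
pose T' := (Num.truncn (ln (1 / eps) / (1 - zeta))).+1.
have [|T Tcompl TT'] := @complexity_exists R
    (fun t => 'E_P[fun w => (frob (x t w - xs) ^+ 2)%R]%E) (eps * Psi0)%:E T'.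
  move=> t T't; apply: le_trans (errP t) _; rewrite lee_fin ler_wpM2r//.
  apply: expr_decay => //; first by rewrite zeta0.
  by apply: ltW; apply: lt_le_trans (truncnS_gt _) _; rewrite ler_nat.
exists T => C logeps; split=> //; first exact: expectation_nb_comms flips K T.
move=> eps_le; have eps01 : 0 < eps <= eps0 by rewrite eps_gt0.
have Tbound : T%:R <= Cst * (Num.max kappa (1 / p ^+ 2) * logeps).
  apply: le_trans (iteration_bound c'0 delta0 heps0 eps01 kappa0 p01).
  by rewrite ler_nat.
set s := Num.sqrt (1 - rho).
have /andP[rho0 rho1] : 0 < rho < 1 := net_rho01 net.
have s0 : 0 < s by rewrite sqrtr_gt0 subr_gt0.
(* Each bound on [T] transfers to [C] through $K\le1/\sqrt{1-\rho}$. *)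
have CT X : T%:R <= Cst * (X * logeps) -> C <= Cst * (p * X / s * logeps).
  move=> TX; have /andP[_ Ks] := rounds_ge (net_rho01 net).
  have Ks' : K%:R <= s^-1 by rewrite -[leRHS]mul1r ler_pdivlMr.
  have -> : Cst * (p * X / s * logeps) = p * s^-1 * (Cst * (X * logeps)) by ring.
  by rewrite /C ler_pM// ?mulr_ge0 ?ler0n ?(ltW p0)// ler_wpM2l// ltW.
have Tcase : T%:R <= Cst * (kappa * logeps) \/ T%:R <= Cst * (1 / p ^+ 2 * logeps).
  by move: Tbound; case: (leP kappa (1 / p ^+ 2)) => _ ?; [right|left].
have cheap : 1 / Num.sqrt kappa <= p <= 1 ->
    T%:R <= Cst * (kappa * logeps) /\ C <= Cst * (p * kappa / s * logeps).
  case/andP=> pk _; have Tk : T%:R <= Cst * (kappa * logeps); last first.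
    by split=> //; exact: CT.
  (* For $p\ge1/\sqrt\kappa$ we have $1/p^2\le\kappa$, so the maximum is $\kappa$. *)
  move: Tbound; rewrite (max_l _)// ler_pdivrMr//.
  move: pk; rewrite ler_pdivrMr ?sqrtr_gt0// => pk.
  have -> : kappa * p ^+ 2 = (p * Num.sqrt kappa) ^+ 2.
    by rewrite exprMn sqr_sqrtr ?(ltW kappa0)// mulrC.
  exact: exprn_ege1.
split=> //.
- by rewrite le_max; case: Tcase => ->; rewrite ?orbT.
- rewrite le_max; case: Tcase => /CT; first by move=> ->.
  have -> : p * (1 / p ^+ 2) / s = 1 / (p * s) by field; rewrite !lt0r_neq0.
  by move=> ->; rewrite orbT.
- move=> pk; have [|Tk Ck] := cheap; first by rewrite -pk lexx p1.
  split=> //; suff <- : p * kappa / s = Num.sqrt (kappa / (1 - rho)) by [].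
  rewrite sqrtrM ?(ltW kappa0)// sqrtrV ?subr_ge0 ?(ltW rho1)// -/s pk.
  rewrite -{2}(sqr_sqrtr (ltW kappa0)) expr2 mul1r mulrA mulVf ?mul1r//.
  by rewrite gt_eqF// sqrtr_gt0.
Qed.
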